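(* Let $(\mathcal M,g)$ be a Lorentzian conformally recurrent manifold of dimension $n\ge 5$ with time-like recurrence vector $\alpha_i$ ($\alpha^2=\alpha^k\alpha_k<0$). Then the Weyl tensor is purely electric (with respect to the unit time-like vector $u_i=\alpha_i/\sqrt{-\alpha^2}$).
   Context: Manifolds are smooth, connected, Hausdorff; Lorentzian means that the metric $g$ has one negative and $n-1$ positive eigenvalues (signature $n-2$); $\nabla$ is the Levi-Civita connection. Let $R_{jkl}{}^m$ be the Riemann tensor ($[\nabla_j,\nabla_k]v_l=R_{jkl}{}^m v_m$), $R_{kl}=-R_{mkl}{}^m$ the Ricci tensor, $R=g^{ij}R_{ij}$. The Weyl tensor is $$C_{jkl}{}^m=R_{jkl}{}^m+\tfrac{1}{n-2}(\delta_j{}^mR_{kl}-\delta_k{}^mR_{jl}+R_j{}^mg_{kl}-R_k{}^mg_{jl})-R\,\frac{\delta_j{}^mg_{kl}-\delta_k{}^mg_{jl}}{(n-1)(n-2)}.$$ $(\mathcal M,g)$ is conformally recurrent if $\nabla_iC_{jklm}=\alpha_iC_{jklm}$ for a non-zero covector field $\alpha_i$, called the recurrence vector. Given a time-like vector $u_k$ with $u^ku_k=-1$, put $\theta_{kl}=g_{kl}+u_ku_l$. The magnetic component of the Weyl tensor with respect to $u$ is $$(C_-)^{jk}{}_{ml}=2\theta^{jr}\theta^{ks}C_{rsp[l}u_{m]}u^p+2u_pu^{[j}C^{k]prs}\theta_{rl}\theta_{sm},$$ where square brackets denote antisymmetrization. The Weyl tensor is purely electric (with respect to $u$) if $C_-=0$.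 *)

(* Defs.v *)
From HB Require Import structures.
From mathcomp Require Import all_boot all_order all_algebra.
From mathcomp Require Import all_classical all_reals all_analysis.

Set Implicit Arguments.
Unset Strict Implicit.
Unset Printing Implicit Defensive.

Import Order.TTheory GRing.Theory Num.Theory.
Import numFieldNormedType.Exports.

Local Open Scope classical_set_scope.
Local Open Scope ring_scope.

Section Smooth.
Variables (R : realType) (n : nat).
Implicit Types (U : set 'rV[R]_n) (f : 'rV[R]_n -> R).

Definition partial (i : 'I_n) f : 'rV[R]_n -> R :=
  fun x => 'D_(delta_mx 0 i) f x.

(** All partial derivatives of order at most [k] exist and are continuous on
    [U]; [U] is meant to be open. *)
Fixpoint Ck (k : nat) U f : Prop :=
  (forall x, U x -> {for x, continuous f}) /\
  (if k is k'.+1 then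
     forall i : 'I_n,
       (forall x, U x -> derivable f x (delta_mx 0 i)) /\ Ck k' U (partial i f)
   else True).

Definition smooth_on U f : Prop := forall k, Ck k U f.

End Smooth.

Record chart (R : realType) (n : nat) (M : topologicalType) := Chart {
  chart_dom : set M;
  chart_cod : set 'rV[R]_n;
  chart_map : M -> 'rV[R]_n;
  chart_inv : 'rV[R]_n -> M;
  chart_dom_open : open chart_dom;
  chart_cod_open : open chart_cod;
  chart_map_cod : forall p, chart_dom p -> chart_cod (chart_map p);
  chart_inv_dom : forall x, chart_cod x -> chart_dom (chart_inv x);
  chart_mapK : forall p, chart_dom p -> chart_inv (chart_map p) = p;
  chart_invK : forall x, chart_cod x -> chart_map (chart_inv x) = x;
  chart_map_cont : forall p, chart_dom p -> {for p, continuous chart_map};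
  chart_inv_cont : forall x, chart_cod x -> {for x, continuous chart_inv}
}.

(** The change of coordinates from [c] to [d] and the (open) subset of the
    codomain of [c] on which it is meaningful. *)
Definition trans_dom (R : realType) (n : nat) (M : topologicalType)
    (c d : chart R n M) : set 'rV[R]_n :=
  [set x | chart_cod c x /\ chart_dom d (chart_inv c x)].

Definition trans (R : realType) (n : nat) (M : topologicalType)
    (c d : chart R n M) (x : 'rV[R]_n) : 'rV[R]_n :=
  chart_map d (chart_inv c x).

Record smooth_manifold (R : realType) (n : nat) := SmoothManifold {
  carrier :> topologicalType;
  chart_idx : Type;
  atlas : chart_idx -> chart R n carrier;
  manifold_hausdorff : hausdorff_space carrier;
  manifold_connected : connected [set: carrier];
  atlas_cover : forall p : carrier, exists c, chart_dom (atlas c) p;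
  atlas_smooth : forall (c d : chart_idx) (a : 'I_n),
    smooth_on (trans_dom (atlas c) (atlas d))
              (fun x => trans (atlas c) (atlas d) x 0 a)
}.

Section Fields.
Variables (R : realType) (n : nat) (M : smooth_manifold R n).

(** Entry (a, i) is dy^a/dx^i, for x the coordinates of [c] and y those of
    [d]. *)
Definition trans_jac (c d : chart_idx M) (x : 'rV[R]_n) : 'M[R]_n :=
  \matrix_(a, i) partial i (fun z => trans (atlas c) (atlas d) z 0 a) x.

(** Tensor fields are given by their components in each chart of the atlas, as
    functions of the coordinates; components outside the codomain of the chart
    are junk. *)

Record covector_field := CovectorField {
  cov_comp :> chart_idx M -> 'rV[R]_n -> 'rV[R]_n;
  cov_smooth : forall c i,
    smooth_on (chart_cod (atlas c)) (fun x => cov_comp c x 0 i);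
  cov_trans : forall c d x, trans_dom (atlas c) (atlas d) x ->
    cov_comp c x =
    cov_comp d (trans (atlas c) (atlas d) x) *m trans_jac c d x
}.

Record sym_tensor_field := SymTensorField {
  met_comp :> chart_idx M -> 'rV[R]_n -> 'M[R]_n;
  met_smooth : forall c i j,
    smooth_on (chart_cod (atlas c)) (fun x => met_comp c x i j);
  met_sym : forall c x, chart_cod (atlas c) x -> (met_comp c x)^T = met_comp c x;
  met_trans : forall c d x, trans_dom (atlas c) (atlas d) x ->
    met_comp c x =
    (trans_jac c d x)^T *m met_comp d (trans (atlas c) (atlas d) x)
      *m trans_jac c d x
}.

End Fields.

(** [s] lists the eigenvalues with multiplicity. *)
Definition lorentz_signature (R : realType) (n : nat) (A : 'M[R]_n) : Prop :=
  exists s : seq R,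
    [/\ char_poly A = \prod_(z <- s) ('X - z%:P),
        count (fun z => z < 0) s = 1%N
      & count (fun z => 0 < z) s = n.-1].

Definition lorentzian (R : realType) (n : nat) (M : smooth_manifold R n)
    (g : sym_tensor_field M) : Prop :=
  forall c x, chart_cod (atlas c) x -> lorentz_signature (g c x).

Section Curvature.
Variables (R : realType) (n : nat) (G : 'rV[R]_n -> 'M[R]_n).
Local Notation V := 'rV[R]_n.
Local Notation I := 'I_n.

Definition ginv (x : V) : 'M[R]_n := invmx (G x).

(** [christoffel m i j] is Gamma^m_{ij}. *)
Definition christoffel (m i j : I) (x : V) : R :=
  2^-1 * \sum_(p < n) ginv x m p *
    (partial i (fun y => G y p j) x + partial j (fun y => G y p i) x
     - partial p (fun y => G y i j) x).

(** Covariant derivatives of covariant tensors of rank 1, 2 and 4; the index of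
    differentiation comes first. *)
Definition nabla1 (v : I -> V -> R) (i j : I) (x : V) : R :=
  partial i (v j) x - \sum_(p < n) christoffel p i j x * v p x.

Definition nabla2 (T : I -> I -> V -> R) (i j k : I) (x : V) : R :=
  partial i (T j k) x
  - \sum_(p < n) christoffel p i j x * T p k x
  - \sum_(p < n) christoffel p i k x * T j p x.

Definition nabla4 (T : I -> I -> I -> I -> V -> R) (i j k l m : I) (x : V) : R :=
  partial i (T j k l m) x
  - \sum_(p < n) christoffel p i j x * T p k l m x
  - \sum_(p < n) christoffel p i k x * T j p l m x
  - \sum_(p < n) christoffel p i l x * T j k p m x
  - \sum_(p < n) christoffel p i m x * T j k l p x.

Definition dx (m : I) : I -> V -> R := fun l _ => (l == m)%:R.

(** R_{jkl}^m, with the convention [nabla_j, nabla_k] v_l = R_{jkl}^m v_m: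
    both sides are C^oo-linear in v, so the components are obtained by taking
    v = dx^m. *)
Definition riemann (j k l m : I) (x : V) : R :=
  nabla2 (nabla1 (dx m)) j k l x - nabla2 (nabla1 (dx m)) k j l x.

Definition ricci (k l : I) (x : V) : R := - \sum_(m < n) riemann m k l m x.

(** R_j^m *)
Definition ricci_mixed (j m : I) (x : V) : R :=
  \sum_(p < n) ricci j p x * ginv x p m.

Definition scalar_curv (x : V) : R :=
  \sum_(i < n) \sum_(j < n) ginv x i j * ricci i j x.

Definition delta (j m : I) : R := (j == m)%:R.

(** C_{jkl}^m *)
Definition weyl_mixed (j k l m : I) (x : V) : R :=
  riemann j k l m x
  + (n%:R - 2)^-1 *
      (delta j m * ricci k l x - delta k m * ricci j l x
       + ricci_mixed j m x * G x k l - ricci_mixed k m x * G x j l)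
  - scalar_curv x * ((delta j m * G x k l - delta k m * G x j l)
                     / ((n%:R - 1) * (n%:R - 2))).

(** C_{jklm} *)
Definition weyl (j k l m : I) (x : V) : R :=
  \sum_(p < n) weyl_mixed j k l p x * G x p m.

End Curvature.

Section Magnetic.
Variables (R : realType) (n : nat).
Variables (G : 'M[R]_n) (C : 'I_n -> 'I_n -> 'I_n -> 'I_n -> R) (u : 'rV[R]_n).
Local Notation I := 'I_n.

(** u^j, from the covariant components u_k *)
Definition raise (j : I) : R := \sum_(k < n) invmx G j k * u 0 k.

Definition norm2 : R := \sum_(k < n) raise k * u 0 k.

Definition theta (k l : I) : R := G k l + u 0 k * u 0 l.

Definition theta_up (j r : I) : R :=
  \sum_(a < n) \sum_(b < n) invmx G j a * invmx G r b * theta a b.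

Definition raise4 (k p r s : I) : R :=
  \sum_(a < n) \sum_(b < n) \sum_(c < n) \sum_(d < n)
    invmx G k a * invmx G p b * invmx G r c * invmx G s d * C a b c d.

Definition antisym (T : I -> I -> R) (a b : I) : R := 2^-1 * (T a b - T b a).

(** [magnetic j k m l] is (C_-)^{jk}_{ml}. *)
Definition magnetic (j k m l : I) : R :=
  2 * (\sum_(r < n) \sum_(s < n) \sum_(p < n)
         theta_up j r * theta_up k s
         * antisym (fun a b => C r s p a * u 0 b) l m * raise p)
  + 2 * (\sum_(p < n) \sum_(r < n) \sum_(s < n)
           u 0 p * antisym (fun a b => raise a * raise4 b p r s) j k
           * theta r l * theta s m).

End Magnetic.

Section Properties.
Variables (R : realType) (n : nat) (M : smooth_manifold R n).
Variable g : sym_tensor_field M.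

Definition timelike (alpha : covector_field M) : Prop :=
  forall c x, chart_cod (atlas c) x -> norm2 (g c x) (alpha c x) < 0.

Definition conformally_recurrent (alpha : covector_field M) : Prop :=
  (exists c x, chart_cod (atlas c) x /\ alpha c x <> 0) /\
  (forall c x, chart_cod (atlas c) x -> forall i j k l m : 'I_n,
     nabla4 (g c) (weyl (g c)) i j k l m x
     = alpha c x 0 i * weyl (g c) j k l m x).

Definition unit_covector (alpha : covector_field M) :
    chart_idx M -> 'rV[R]_n -> 'rV[R]_n :=
  fun c x => (Num.sqrt (- norm2 (g c x) (alpha c x)))^-1 *: alpha c x.

Definition weyl_purely_electric (u : chart_idx M -> 'rV[R]_n -> 'rV[R]_n) : Prop :=
  forall c x, chart_cod (atlas c) x -> forall j k m l : 'I_n,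
    magnetic (g c x) (fun a b d e => weyl (g c) a b d e x) (u c x) j k m l = 0.

End Properties.

(* Main.v *)
(** Write X_jkl = alpha^m C_jklm, and let n be the dimension.  Splitting the
    Riemann tensor as the Weyl tensor plus a Kulkarni-Nomizu product of g with
    the Schouten tensor, the second Bianchi identity and the recurrence of the
    Weyl tensor give

      alpha_i C_jklm + alpha_j C_kilm + alpha_k C_ijlm
        = g_jm A_ikl + g_km A_jil + g_im A_kjl - (l <-> m),

    where A is the Cotton tensor.  Tracing over i, m (and once more) yields
    X = (3 - n) A.  Contracting with alpha^i alpha^m and substituting A leaves
    alpha^2 (n - 4)/(n - 3) X_jkl = alpha_j Y_kl + alpha_k Z_jl for some Y, Z;
    as n >= 5, X has no component purely transverse to alpha in j and k, which
    is what the vanishing of the magnetic part means. *)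

Require Import Defs.
From mathcomp Require Import all_boot all_order all_algebra.
From mathcomp Require Import all_classical all_reals all_analysis.
From mathcomp Require Import ring lra.

Set Implicit Arguments.
Unset Strict Implicit.
Unset Printing Implicit Defensive.

Import Order.TTheory GRing.Theory Num.Theory.
Import numFieldNormedType.Exports.

Local Open Scope classical_set_scope.
Local Open Scope ring_scope.

(** * Smooth functions on an open set *)

(** All tensors are components on the open codomain of one chart, and the claim is proved at one
    point of it. Calculus ends with the Bianchi identity for the Weyl tensor at that point; the rest
    is linear algebra with a matrix [G] and its inverse [H]. Two facts make this algebra close.
    First, alpha^l X_jkl = 0 by the antisymmetry of C_jklm in l and m, hence alpha^l A_jkl = 0
    because A is proportional to X; so the terms with l and m exchanged disappear after contraction
    with alpha^m. Second, alpha^2 X_jkl occurs once directly and once through the A that is replaced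
    by X/(3 - n), with total coefficient 1 + 1/(3 - n), which vanishes exactly for n = 4. That alpha
    is time-like allows division by alpha^2 and gives u^2 = -1, so that theta annihilates u. Each
    half of the magnetic part is a contraction of C with u in one index pair, projected by theta on
    the other pair. *)

Section SmoothCalculus.
Variables (R : realType) (n : nat) (U : set 'rV[R]_n).
Hypothesis U_open : open U.
Implicit Types (f g : 'rV[R]_n -> R).

Lemma near_open x : U x -> \forall y \near x, U y.
Proof. by move=> Ux; apply: open_nbhs_nbhs. Qed.

Lemma partial_ext f g x (i : 'I_n) :
  (forall y, U y -> f y = g y) -> U x -> partial i f x = partial i g x.
Proof.
move=> fg Ux; apply: near_eq_derive.
by apply: filterS (near_open Ux) => y; exact: fg.
Qed.

Lemma continuous_ext_on f g x : (forall y, U y -> f y = g y) -> U x ->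
  {for x, continuous f} -> {for x, continuous g}.
Proof.
move=> fg Ux; rewrite /prop_for /continuous_at -(fg _ Ux).
apply: cvg_trans; apply: (@near_eq_cvg _ _ (nbhs x)); near=> y.
by rewrite fg//; near: y; exact: near_open.
Unshelve. all: by end_near. Qed.

(** Components are junk outside the chart, so identities between them hold on [U] only. Since [U] is
    open, derivatives at its points do not see the junk. *)
Lemma Ck_ext k f g : (forall y, U y -> f y = g y) -> Ck k U f -> Ck k U g.
Proof.
elim: k f g => [|k IH] f g fg [cf df]; split=> //.
- by move=> x Ux; exact: continuous_ext_on fg Ux (cf x Ux).
- by move=> x Ux; exact: continuous_ext_on fg Ux (cf x Ux).
- move=> i; have [dfi ci] := df i; split.
    move=> x Ux; apply: near_eq_derivable (dfi x Ux).
    by apply: filterS (near_open Ux) => y /fg.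
  by apply: IH ci => x Ux; apply: partial_ext.
Qed.

Lemma CkW k f : Ck k.+1 U f -> Ck k U f.
Proof.
elim: k f => [|k IH] f [cf df]; split=> // i.
by have [dfi ci] := df i; split=> //; apply: IH.
Qed.

Lemma Ck_cst k (c : R) : Ck k U (fun=> c).
Proof.
elim: k c => [|k IH] c; split=> //.
- by move=> x _; exact: cst_continuous.
- by move=> x _; exact: cst_continuous.
move=> i; split; first by move=> x _; exact: derivable_cst.
by apply: Ck_ext (IH 0) => x _; rewrite /partial derive_cst.
Qed.

Lemma CkD k f g : Ck k U f -> Ck k U g -> Ck k U (fun x => f x + g x).
Proof.
elim: k f g => [|k IH] f g [cf df] [cg dg]; split=> //.
- by move=> x Ux; apply: continuousD; [exact: cf|exact: cg].
- by move=> x Ux; apply: continuousD; [exact: cf|exact: cg].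
move=> i; have [dfi cfi] := df i; have [dgi cgi] := dg i; split.
  by move=> x Ux; apply: derivableD; [exact: dfi|exact: dgi].
apply: Ck_ext (IH _ _ cfi cgi) => x Ux.
by rewrite /partial [RHS]deriveD//; [exact: dfi|exact: dgi].
Qed.

Lemma CkN k f : Ck k U f -> Ck k U (fun x => - f x).
Proof.
elim: k f => [|k IH] f [cf df]; split=> //.
- by move=> x Ux; apply: continuousN; exact: cf.
- by move=> x Ux; apply: continuousN; exact: cf.
move=> i; have [dfi cfi] := df i; split.
  by move=> x Ux; apply: derivableN; exact: dfi.
apply: Ck_ext (IH _ cfi) => x Ux.
by rewrite /partial [RHS]deriveN//; exact: dfi.
Qed.

(** The product rule multiplies a derivative of one factor by the other factor undifferentiated;
    [CkW] lowers the latter to the order at which the induction hypothesis applies. *)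
Lemma CkM k f g : Ck k U f -> Ck k U g -> Ck k U (fun x => f x * g x).
Proof.
elim: k f g => [|k IH] f g Cf Cg; have [cf df] := Cf; have [cg dg] := Cg;
  split=> //.
- by move=> x Ux; apply: continuousM; [exact: cf|exact: cg].
- by move=> x Ux; apply: continuousM; [exact: cf|exact: cg].
move=> i; have [dfi cfi] := df i; have [dgi cgi] := dg i; split.
  by move=> x Ux; apply: derivableM; [exact: dfi|exact: dgi].
apply: Ck_ext (CkD (IH _ _ (CkW Cf) cgi) (IH _ _ cfi (CkW Cg))) => x Ux.
rewrite /partial [RHS]deriveM//; [|exact: dfi|exact: dgi].
by rewrite /GRing.scale/= [g x * _]mulrC.
Qed.

Lemma CkV k f : (forall x, U x -> f x != 0) -> Ck k U f ->
  Ck k U (fun x => (f x)^-1).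
Proof.
move=> f0; elim: k => [|k IH] Cf; have [cf df] := Cf; split=> //.
- by move=> x Ux; apply: continuousV; [exact: f0|exact: cf].
- by move=> x Ux; apply: continuousV; [exact: f0|exact: cf].
move=> i; have [dfi cfi] := df i; split.
  by move=> x Ux; apply: derivableV; [exact: f0|exact: dfi].
have IHk := IH (CkW Cf).
apply: Ck_ext (CkN (CkM (CkM IHk IHk) cfi)) => x Ux.
rewrite /partial [RHS]deriveV//; [|exact: f0|exact: dfi].
by rewrite /GRing.scale/= mulNr expr2 -invfM.
Qed.

Lemma smooth_ext f g : (forall y, U y -> f y = g y) ->
  smooth_on U f -> smooth_on U g.
Proof. by move=> fg sf k; exact: Ck_ext fg (sf k). Qed.

Lemma smooth_cst (c : R) : smooth_on U (fun=> c).
Proof. by move=> k; exact: Ck_cst. Qed.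

Lemma smoothD f g :
  smooth_on U f -> smooth_on U g -> smooth_on U (fun x => f x + g x).
Proof. by move=> sf sg k; exact: CkD (sf k) (sg k). Qed.

Lemma smoothN f : smooth_on U f -> smooth_on U (fun x => - f x).
Proof. by move=> sf k; exact: CkN (sf k). Qed.

Lemma smoothB f g :
  smooth_on U f -> smooth_on U g -> smooth_on U (fun x => f x - g x).
Proof. by move=> sf sg; exact: smoothD sf (smoothN sg). Qed.

Lemma smoothM f g :
  smooth_on U f -> smooth_on U g -> smooth_on U (fun x => f x * g x).
Proof. by move=> sf sg k; exact: CkM (sf k) (sg k). Qed.

Lemma smoothV f : (forall x, U x -> f x != 0) ->
  smooth_on U f -> smooth_on U (fun x => (f x)^-1).
Proof. by move=> f0 sf k; exact: CkV f0 (sf k). Qed.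

Lemma smooth_partial f i : smooth_on U f -> smooth_on U (partial i f).
Proof. by move=> sf k; have [_ /(_ i)[]] := sf k.+1. Qed.

Lemma smooth_sum (T : Type) (r : seq T) (P : pred T) (F : T -> 'rV[R]_n -> R) :
  (forall t, smooth_on U (F t)) ->
  smooth_on U (fun x => \sum_(t <- r | P t) F t x).
Proof.
move=> sF; elim: r => [|t r IH].
  by apply: smooth_ext (smooth_cst 0) => x _; rewrite big_nil.
case: (boolP (P t)) => Pt.
  by apply: smooth_ext (smoothD (sF t) IH) => x _; rewrite big_cons Pt.
by apply: smooth_ext IH => x _; rewrite big_cons (negbTE Pt).
Qed.

Lemma smooth_prod (T : Type) (r : seq T) (F : T -> 'rV[R]_n -> R) :
  (forall t, smooth_on U (F t)) ->
  smooth_on U (fun x => \prod_(t <- r) F t x).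
Proof.
move=> sF; elim: r => [|t r IH].
  by apply: smooth_ext (smooth_cst 1) => x _; rewrite big_nil.
by apply: smooth_ext (smoothM (sF t) IH) => x _; rewrite big_cons.
Qed.

Lemma smooth_det m (A : 'rV[R]_n -> 'M[R]_m) :
  (forall i j, smooth_on U (fun x => A x i j)) ->
  smooth_on U (fun x => \det (A x)).
Proof.
move=> sA; apply: smooth_sum => s; apply: smoothM; first exact: smooth_cst.
by apply: smooth_prod => i; exact: sA.
Qed.

(** Cramer's rule: cofactors and determinant are polynomials in the entries, and the determinant has
    no zero on [U]. *)
Lemma smooth_invmx m (A : 'rV[R]_n -> 'M[R]_m) :
  (forall i j, smooth_on U (fun x => A x i j)) ->
  (forall x, U x -> A x \in unitmx) ->
  forall i j, smooth_on U (fun x => invmx (A x) i j).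
Proof.
move=> sA uA i j.
have sadj : smooth_on U (fun x => (\adj (A x)) i j).
  apply: (@smooth_ext (fun x => cofactor (A x) j i)).
    by move=> y _; rewrite mxE.
  apply: smoothM; first exact: smooth_cst.
  apply: smooth_det => a b.
  by apply: smooth_ext (sA (lift j a) (lift i b)) => y _; rewrite !mxE.
have d0 x : U x -> \det (A x) != 0.
  by move=> /uA; rewrite unitmxE unitfE.
apply: smooth_ext (smoothM (smoothV d0 (smooth_det sA)) sadj) => y Uy.
by rewrite /invmx uA// [RHS]mxE.
Qed.

Lemma smooth_derivable f i x : smooth_on U f -> U x ->
  derivable f x (delta_mx 0 i).
Proof. by move=> /(_ 1)[_ /(_ i)[+ _]] Ux; apply. Qed.

Lemma smooth_continuous f x : smooth_on U f -> U x -> {for x, continuous f}.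
Proof. by move=> /(_ 0)[+ _] Ux; apply. Qed.

Section Rules.
Variables (x : 'rV[R]_n) (i : 'I_n).
Hypothesis Ux : U x.

Lemma partial_cst (c : R) : partial i (fun=> c) x = 0.
Proof. by rewrite /partial derive_cst. Qed.

Lemma partialD f g : smooth_on U f -> smooth_on U g ->
  partial i (fun y => f y + g y) x = partial i f x + partial i g x.
Proof. by move=> sf sg; apply: deriveD; exact: smooth_derivable. Qed.

Lemma partialN f : smooth_on U f ->
  partial i (fun y => - f y) x = - partial i f x.
Proof. by move=> sf; apply: deriveN; exact: smooth_derivable. Qed.

Lemma partialB f g : smooth_on U f -> smooth_on U g ->
  partial i (fun y => f y - g y) x = partial i f x - partial i g x.
Proof. by move=> sf sg; apply: deriveB; exact: smooth_derivable. Qed.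

Lemma partialM f g : smooth_on U f -> smooth_on U g ->
  partial i (fun y => f y * g y) x = partial i f x * g x + f x * partial i g x.
Proof.
move=> sf sg; rewrite /partial [LHS]deriveM; try exact: smooth_derivable.
by rewrite addrC /GRing.scale/= [g x * _]mulrC.
Qed.

Lemma partial_sum (T : Type) (r : seq T) (F : T -> 'rV[R]_n -> R) :
  (forall t, smooth_on U (F t)) ->
  partial i (fun y => \sum_(t <- r) F t y) x = \sum_(t <- r) partial i (F t) x.
Proof.
move=> sF; elim: r => [|t r IH].
  rewrite big_nil; transitivity (partial i (fun=> 0) x); last exact: partial_cst.
  by apply: partial_ext => // y _; rewrite big_nil.
rewrite big_cons -IH -partialD//; last exact: smooth_sum.
by apply: partial_ext => // y _; rewrite big_cons.
Qed.

End Rules.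
End SmoothCalculus.

(** * Symmetry of second derivatives *)

Section MixedPartials.
Variables (R : realType) (V : normedModType R).
Implicit Types (f : V -> R) (x a b : V).

Lemma is_derive_line f x a (s : R) : derivable f (s *: a + x) a ->
  is_derive s 1 (fun t : R => f (t *: a + x)) ('D_a f (s *: a + x)).
Proof.
move=> df.
have E : (fun h : R => h^-1 *: (((fun t : R => f (t *: a + x)) \o shift s) (h *: 1)
      - f (s *: a + x)))
  = (fun h : R => h^-1 *: ((f \o shift (s *: a + x)) (h *: a) - f (s *: a + x))).
  by apply/funext => h /=; rewrite scalerDl addrA [h *: 1]mulr1.
by split; rewrite ?/derivable ?/derive E.
Qed.

(* The mean value theorem, once along [a] and once along [b]. *)
Lemma second_difference f x a b (h : R) : 0 < h ->
  (forall s t, 0 <= s <= h -> 0 <= t <= h ->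
     derivable f (s *: a + (t *: b + x)) a /\
     derivable ('D_a f) (s *: a + (t *: b + x)) b) ->
  exists s t, [/\ 0 <= s <= h, 0 <= t <= h &
    f (h *: a + (h *: b + x)) - f (h *: a + x) - f (h *: b + x) + f x =
    'D_b ('D_a f) (s *: a + (t *: b + x)) * h * h].
Proof.
move=> h0 df.
have hh : 0 <= h <= h by rewrite lexx ltW.
have h00 : 0 <= (0 : R) <= h by rewrite lexx ltW.
pose phi (s : R) := f (s *: a + (h *: b + x)) - f (s *: a + x).
have dphi s : 0 <= s <= h ->
    is_derive s 1 phi ('D_a f (s *: a + (h *: b + x)) - 'D_a f (s *: a + x)).
  move=> sh.
  have d1 : derivable f (s *: a + (h *: b + x)) a by have [] := df s h sh hh.
  have d2 : derivable f (s *: a + x) a.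
    by have [] := df s 0 sh h00; rewrite scale0r add0r.
  exact: is_deriveB (is_derive_line d1) (is_derive_line d2).
have [||s + Es] := @MVT R phi
  (fun s => 'D_a f (s *: a + (h *: b + x)) - 'D_a f (s *: a + x)) 0 h h0.
- by move=> s; rewrite in_itv/= => /andP[s0 sh]; apply: dphi; rewrite !ltW.
- apply: derivable_within_continuous => s; rewrite in_itv/= => sh.
  by have [] := dphi s sh.
rewrite in_itv/= => /andP[s0 sh].
have sI : 0 <= s <= h by rewrite !ltW.
pose psi (t : R) := 'D_a f (t *: b + (s *: a + x)).
have dpsi t : 0 <= t <= h ->
    is_derive t 1 psi ('D_b ('D_a f) (t *: b + (s *: a + x))).
  move=> th; apply: is_derive_line.
  by have [_] := df s t sI th; rewrite addrCA.
have [||t + Et] := @MVT R psi (fun t => 'D_b ('D_a f) (t *: b + (s *: a + x))) 0 h h0.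
- by move=> t; rewrite in_itv/= => /andP[t0 th]; apply: dpsi; rewrite !ltW.
- apply: derivable_within_continuous => t; rewrite in_itv/= => th.
  by have [] := dpsi t th.
rewrite in_itv/= => /andP[t0 th].
exists s, t; split => //; first by rewrite !ltW.
move: Es Et; rewrite /phi /psi !subr0 !scale0r !add0r.
rewrite [t *: b + _]addrCA [h *: b + (s *: a + _)]addrCA => Es <-.
by rewrite -Es; ring.
Qed.

(** The mean value theorem yields different intermediate points for the two orders of
    differentiation, and only their distance to [x] is controlled; hence the separate [y] and
    [z]. *)
Lemma continuous_eq_of_near (p q : V -> R) x :
  {for x, continuous p} -> {for x, continuous q} ->
  (forall r : R, 0 < r -> exists y z, [/\ `|y - x| < r, `|z - x| < r & p y = q z]) ->
  p x = q x.
Proof.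
move=> cp cq pq.
apply/eqP; rewrite -subr_eq0 -normr_le0; apply/ler_addgt0Pl => e e0.
rewrite addr0.
have e20 : 0 < e / 2 by rewrite divr_gt0.
have /nbhs_ballP[r1 /= r10 H1] : \forall y \near x, `|p x - p y| < e / 2.
  by move/cvgrPdist_lt: cp; exact.
have /nbhs_ballP[r2 /= r20 H2] : \forall y \near x, `|q x - q y| < e / 2.
  by move/cvgrPdist_lt: cq; exact.
have [|y [z [yr zr E]]] := pq (Num.min r1 r2); first by rewrite lt_min r10.
move: yr zr; rewrite !lt_min => /andP[yr _] /andP[_ zr].
have B1 : `|p x - p y| < e / 2 by apply: H1; rewrite -ball_normE /= distrC.
have B2 : `|q x - q z| < e / 2 by apply: H2; rewrite -ball_normE /= distrC.
have -> : p x - q x = (p x - p y) + (q z - q x) by rewrite E; ring.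
by rewrite (le_trans (ler_normD _ _))// [leRHS]splitr ltW// ltrD// distrC.
Qed.

(** The second difference of [f] along [a] and [b] is symmetric in [a] and [b]. By
    [second_difference] it equals h^2 times either mixed derivative at some point near [x], and
    continuity carries the equality to [x]. *)
Lemma mixed_partials f x a b (U : set V) : open U -> U x ->
  (forall y, U y -> derivable f y a /\ derivable ('D_a f) y b) ->
  (forall y, U y -> derivable f y b /\ derivable ('D_b f) y a) ->
  {for x, continuous ('D_b ('D_a f))} -> {for x, continuous ('D_a ('D_b f))} ->
  'D_b ('D_a f) x = 'D_a ('D_b f) x.
Proof.
move=> oU Ux dfab dfba cba cab.
apply: continuous_eq_of_near cba cab _ => r r0.
have /nbhs_ballP[r1 /= r10 near_U] : \forall y \near x, U y by apply: open_nbhs_nbhs.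
pose rm := Num.min r1 r.
have rm0 : 0 < rm by rewrite lt_min r10.
(* The summand 1 keeps the denominator positive when both directions vanish, and makes the bound in
   [small] strict. *)
pose h := rm / (`|a| + `|b| + 1).
have k0 : 0 < `|a| + `|b| + 1 by rewrite ltr_wpDl// addr_ge0.
have h0 : 0 < h by rewrite divr_gt0.
have small s t : 0 <= s <= h -> 0 <= t <= h ->
    `|s *: a + (t *: b + x) - x| < rm.
  move=> /andP[s0 sh] /andP[t0 th].
  rewrite addrA addrK (le_lt_trans (ler_normD _ _))// !normrZ !ger0_norm//.
  have <- : h * (`|a| + `|b| + 1) = rm by rewrite divfK// gt_eqF.
  have sa : s * `|a| <= h * `|a| by rewrite ler_wpM2r.
  have tb : t * `|b| <= h * `|b| by rewrite ler_wpM2r.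
  by rewrite 2!mulrDr mulr1 ltr_pwDr// lerD.
have inU s t : 0 <= s <= h -> 0 <= t <= h -> U (s *: a + (t *: b + x)).
  move=> sh th; apply: near_U; rewrite -ball_normE /= distrC.
  by have := small s t sh th; rewrite lt_min => /andP[].
have [s [t [sh th E1]]] := second_difference h0
  (fun s t sh th => dfab _ (inU s t sh th)).
have [|t' [s' [th' sh' E2]]] := @second_difference f x b a h h0.
  by move=> t' s' th' sh'; rewrite addrCA; apply: dfba; apply: inU.
exists (s *: a + (t *: b + x)), (t' *: b + (s' *: a + x)); split.
- by have := small s t sh th; rewrite lt_min => /andP[].
- by rewrite addrCA; have := small s' t' sh' th'; rewrite lt_min => /andP[].
have hn0 : h != 0 by rewrite gt_eqF.
apply: (mulIf hn0); apply: (mulIf hn0).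
rewrite -E1 -E2 [h *: b + (h *: a + x)]addrCA; ring.
Qed.

End MixedPartials.

Lemma partialC (R : realType) (n : nat) (U : set 'rV[R]_n) f x (i j : 'I_n) :
  open U -> smooth_on U f -> U x ->
  partial i (partial j f) x = partial j (partial i f) x.
Proof.
move=> oU sf Ux.
have sp k := smooth_partial k sf.
apply: (mixed_partials oU Ux).
- by move=> y Uy; split; [exact: smooth_derivable sf Uy|
    exact: smooth_derivable (sp j) Uy].
- by move=> y Uy; split; [exact: smooth_derivable sf Uy|
    exact: smooth_derivable (sp i) Uy].
- exact: smooth_continuous (smooth_partial i (sp j)) Ux.
- exact: smooth_continuous (smooth_partial j (sp i)) Ux.
Qed.

(** * Contracting the recurrence with the inverse metric *)

Section Contraction.
Variables (R : realFieldType) (n : nat) (G H : 'M[R]_n).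
Hypotheses (GH1 : G *m H = 1%:M) (G_sym : G^T = G).
Implicit Types (S T : 'I_n -> 'I_n -> R) (x y : 'I_n -> R).

Definition contract x y : R := \sum_i x i * y i.
Definition trace2 T : R := \sum_i \sum_m H i m * T i m.

Lemma contractD x y z :
  contract x (fun i => y i + z i) = contract x y + contract x z.
Proof. by rewrite /contract -big_split; apply: eq_bigr => i _; rewrite mulrDr. Qed.

Lemma contractN x y : contract x (fun i => - y i) = - contract x y.
Proof. by rewrite /contract -sumrN; apply: eq_bigr => i _; rewrite mulrN. Qed.

Lemma contractZ x (c : R) y : contract x (fun i => c * y i) = c * contract x y.
Proof. by rewrite /contract mulr_sumr; apply: eq_bigr => i _; rewrite mulrCA. Qed.

Lemma contractZr x y (c : R) : contract x (fun i => y i * c) = contract x y * c.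
Proof. by rewrite /contract mulr_suml; apply: eq_bigr => i _; rewrite mulrA. Qed.

Lemma contract0 x : contract x (fun=> 0) = 0.
Proof. by rewrite /contract big1// => i _; rewrite mulr0. Qed.

Lemma contractC x y T :
  contract x (fun i => contract y (T i)) =
  contract y (fun j => contract x (fun i => T i j)).
Proof.
rewrite /contract; under eq_bigr do rewrite mulr_sumr.
rewrite exchange_big; apply: eq_bigr => j _; rewrite mulr_sumr.
by apply: eq_bigr => i _; rewrite mulrCA.
Qed.

Lemma contract_antisym x T : (forall i j, T i j = - T j i) ->
  contract x (fun i => contract x (T i)) = 0.
Proof.
move=> aT; set s := LHS.
have : s = - s.
  rewrite {2}/s contractC -contractN; congr contract; apply/funext => i.
  by rewrite -contractN; congr contract; apply/funext => j.
by move=> /eqP; rewrite -addr_eq0 -mulr2n mulrn_eq0 => /eqP.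
Qed.

Lemma eq_trace2 S T : (forall i m, S i m = T i m) -> trace2 S = trace2 T.
Proof.
by move=> ST; apply: eq_bigr => i _; apply: eq_bigr => m _; rewrite ST.
Qed.

Lemma trace2D S T : trace2 (fun i m => S i m + T i m) = trace2 S + trace2 T.
Proof.
rewrite /trace2 -big_split; apply: eq_bigr => i _.
by rewrite -big_split; apply: eq_bigr => m _; rewrite mulrDr.
Qed.

Lemma trace2N T : trace2 (fun i m => - T i m) = - trace2 T.
Proof.
rewrite /trace2 -sumrN; apply: eq_bigr => i _.
by rewrite -sumrN; apply: eq_bigr => m _; rewrite mulrN.
Qed.

Lemma trace2Z (c : R) T : trace2 (fun i m => c * T i m) = c * trace2 T.
Proof.
rewrite /trace2 mulr_sumr; apply: eq_bigr => i _.
by rewrite mulr_sumr; apply: eq_bigr => m _; rewrite mulrCA.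
Qed.

Lemma trace2_contract x (T : 'I_n -> 'I_n -> 'I_n -> R) :
  trace2 (fun i m => contract x (T i m)) =
  contract x (fun j => trace2 (fun i m => T i m j)).
Proof.
rewrite /trace2 /contract.
under eq_bigr do under eq_bigr do rewrite mulr_sumr.
under eq_bigr do rewrite exchange_big.
rewrite exchange_big; apply: eq_bigr => j _; rewrite mulr_sumr.
apply: eq_bigr => i _; rewrite mulr_sumr.
by apply: eq_bigr => m _; rewrite mulrCA.
Qed.

Lemma inverse_sym : H^T = H.
Proof.
have HG1 : H^T *m G = 1%:M by rewrite -G_sym -trmx_mul GH1 trmx1.
by rewrite -[LHS]mulmx1 -GH1 mulmxA HG1 mul1mx.
Qed.

Let Gs i j : G i j = G j i. Proof. by rewrite -{1}G_sym mxE. Qed.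
Let Hs i j : H i j = H j i. Proof. by rewrite -{1}inverse_sym mxE. Qed.

Lemma trace2T T : trace2 (fun i m => T m i) = trace2 T.
Proof.
rewrite /trace2 exchange_big; apply: eq_bigr => i _.
by apply: eq_bigr => m _; rewrite Hs.
Qed.

Lemma sum_delta j (x : 'I_n -> R) : \sum_i (1%:M : 'M[R]_n) j i * x i = x j.
Proof.
rewrite (bigD1 j)//= big1 ?addr0; first by rewrite mxE eqxx mul1r.
by move=> i /negbTE ij; rewrite mxE eq_sym ij mul0r.
Qed.

Lemma trace2_metricl j x : trace2 (fun i m => G j m * x i) = x j.
Proof.
rewrite -[RHS]sum_delta -GH1 /trace2; apply: eq_bigr => i _.
rewrite mxE mulr_suml; apply: eq_bigr => m _.
by rewrite mulrCA mulrA [H i m]Hs.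
Qed.

Lemma trace2_metricr j x : trace2 (fun i m => G i j * x m) = x j.
Proof.
rewrite -[LHS]trace2T -[RHS]trace2_metricl.
by apply: eq_trace2 => i m; rewrite Gs.
Qed.

Lemma trace2_metric (c : R) : trace2 (fun i m => G i m * c) = n%:R * c.
Proof.
rewrite /trace2; under eq_bigr => i _ do under eq_bigr do rewrite mulrA.
under eq_bigr do rewrite -mulr_suml.
rewrite -mulr_suml; congr (_ * c).
transitivity (\tr (G *m H)); last by rewrite GH1 mxtrace1.
apply: eq_bigr => i _; rewrite mxE; apply: eq_bigr => m _.
by rewrite Hs mulrC.
Qed.

Variable al : 'I_n -> R.
Definition sharp (j : 'I_n) : R := \sum_k H j k * al k.

Lemma trace2_sharp x : trace2 (fun i m => al i * x m) = contract sharp x.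
Proof.
rewrite -[LHS]trace2T; apply: eq_bigr => i _; rewrite mulr_suml.
by apply: eq_bigr => m _; rewrite mulrA.
Qed.

Lemma contract_sharp_metric j : contract sharp (fun m => G j m) = al j.
Proof.
rewrite -[RHS](trace2_metricl j al) -trace2_sharp.
by apply: eq_trace2 => i m; rewrite mulrC.
Qed.

End Contraction.

(** * Algebraic consequences of the Bianchi identity for a recurrent Weyl tensor *)

Section ConformalAlgebra.
Variables (R : realFieldType) (n : nat) (G H : 'M[R]_n).
Hypotheses (GH1 : G *m H = 1%:M) (G_sym : G^T = G) (n5 : (5 <= n)%N).
Variables (C : 'I_n -> 'I_n -> 'I_n -> 'I_n -> R).
Variables (A : 'I_n -> 'I_n -> 'I_n -> R) (al : 'I_n -> R).
Hypothesis C12 : forall j k l m, C j k l m = - C k j l m.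
Hypothesis C34 : forall j k l m, C j k l m = - C j k m l.
Hypothesis C_trace : forall k l, trace2 H (fun j m => C j k l m) = 0.
Hypothesis A12 : forall i k l, A i k l = - A k i l.
Hypothesis bianchi : forall i j k l m,
  al i * C j k l m + al j * C k i l m + al k * C i j l m =
  G j m * A i k l + G k m * A j i l + G i m * A k j l
  - (G j l * A i k m + G k l * A j i m + G i l * A k j m).
Local Notation a := (sharp H al).
Local Notation tr := (trace2 H).
Local Notation X j k l := (contract a (C j k l)).

Let t k := tr (fun i m => A i k m).

(** In the trace over i and m only the first Weyl term survives, the other two being traces of C. On
    the right, A_jkl is collected with coefficient 2 - n + 1. *)
Lemma cotton_divergence j k l :
  X j k l = (3 - n%:R) * A j k l - G j l * t k + G k l * t j.
Proof.
have trA i : tr (fun j m => A i j m) = - t i.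
  by rewrite -trace2N; apply: eq_trace2 => ? ?.
have trC2 i m : tr (fun j l => C i j m l) = 0.
  rewrite -[RHS]oppr0 -(C_trace i m) -trace2N.
  by apply: eq_trace2 => ? ?.
have := congr1 tr (funext (fun i => funext (bianchi i j k l))).
rewrite !(trace2D, trace2N) !trace2Z (trace2_sharp GH1 G_sym).
rewrite C_trace trC2 !mulr0 !addr0 !(trace2_metricl GH1 G_sym).
rewrite (trace2_metric GH1 G_sym) (trace2_metricr GH1 G_sym) trA -/(t k).
rewrite (A12 k j l) => ->; ring.
Qed.

(** Tracing the previous identity over j and l kills X as well, because C is trace-free, and leaves
    (4 - 2n) t_k = 0. *)
Lemma cotton_trace k : t k = 0.
Proof.
have := congr1 tr (funext (fun j => funext (cotton_divergence j k))).
rewrite trace2_contract.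
rewrite (_ : (fun m => _) = fun=> 0); last first.
  apply/funext => m; rewrite -[RHS]oppr0 -(C_trace k m) -trace2N.
  by apply: eq_trace2 => ? ?.
rewrite contract0 !(trace2D, trace2N, trace2Z) -/(t k).
rewrite (trace2_metric GH1 G_sym) (trace2_metricl GH1 G_sym).
have n0 : 4 - 2 * n%:R != 0 :> R.
  have : 5 <= n%:R :> R by rewrite (ler_nat _ 5).
  by move=> ?; apply/eqP; lra.
move=> E; apply/eqP; rewrite -(inj_eq (mulfI n0)) mulr0; apply/eqP.
rewrite E; ring.
Qed.

Lemma weyl_recurrence_contracted : contract a al != 0 ->
  exists Y Z : 'I_n -> 'I_n -> R,
    forall j k l, X j k l = al j * Y k l + al k * Z j l.
Proof.
move=> N0.
have n5R : 5 <= n%:R :> R by rewrite (ler_nat _ 5).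
have n3 : 3 - n%:R != 0 :> R by apply/eqP; lra.
have n4 : 4 - n%:R != 0 :> R by apply/eqP; lra.
have XA j k l : A j k l = (3 - n%:R)^-1 * X j k l.
  by rewrite cotton_divergence !cotton_trace !mulr0 subr0 addr0 mulKf.
(* A is a multiple of X, and contracting X once more with alpha pairs a symmetric product with the
   antisymmetric last two indices of C. *)
have aA k j : contract a (A k j) = 0.
  rewrite (_ : A k j = fun l => (3 - n%:R)^-1 * X k j l); last first.
    by apply/funext => l; exact: XA.
  by rewrite contractZ contract_antisym ?mulr0//.
set N := contract a al in N0.
(* [K] inverts the coefficient N (1 + 1/(3 - n)) that X_jkl acquires once [E1] is contracted with
   alpha^i. *)
pose K := (3 - n%:R) / (4 - n%:R) / N.
exists (fun k l => K * (contract a (fun i => A i k l) - contract a (fun i => X k i l))).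
exists (fun j l => K * (contract a (fun i => A j i l) - contract a (fun i => X i j l))).
move=> j k l.
have E1 i : al i * X j k l + al j * X k i l + al k * X i j l =
    al j * A i k l + al k * A j i l + al i * A k j l.
  have := congr1 (contract a) (funext (bianchi i j k l)).
  rewrite !(contractD, contractN) !contractZ !contractZr.
  by rewrite !(contract_sharp_metric GH1 G_sym) !aA !mulr0 !addr0 subr0.
have := congr1 (contract a) (funext E1).
rewrite !contractD !contractZ !contractZr -/N (A12 k j l) [A j k l]XA => E2.
apply: (mulfI N0); apply: (mulfI n4); apply: (mulfI n3).
rewrite /K; move: E2.
set x := X j k l; set p := contract a _; set q := contract a _.
set r := contract a _; set s := contract a _ => E2.
(* The first three summands in the parentheses are the left side of [E2], put there to be rewritten;
   the last two undo the added terms. *)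
have -> : (3 - n%:R) * ((4 - n%:R) * (N * x)) = (3 - n%:R) * (3 - n%:R) *
    (N * x + al j * p + al k * q - N * - ((3 - n%:R)^-1 * x)
      - al j * p - al k * q) by field.
by rewrite E2; field; rewrite n4 N0.
Qed.

End ConformalAlgebra.

(** * Vanishing of the magnetic part *)

Section MagneticPart.
Variables (R : realType) (n : nat) (G : 'M[R]_n).
Hypotheses (G_unit : G \in unitmx) (G_sym : G^T = G).
Variables (C : 'I_n -> 'I_n -> 'I_n -> 'I_n -> R) (u : 'rV[R]_n).
Hypothesis C34 : forall j k l m, C j k l m = - C j k m l.
Hypothesis C_pair : forall j k l m, C j k l m = C l m j k.
Variables Y Z : 'I_n -> 'I_n -> R.
Hypothesis C_u : forall j k l,
  contract (raise G u) (C j k l) = u 0 j * Y k l + u 0 k * Z j l.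
Hypothesis u_unit : norm2 G u = - 1.

Let Gs i j : G i j = G j i. Proof. by rewrite -{1}G_sym mxE. Qed.
Let GH1 : G *m invmx G = 1%:M. Proof. exact: mulmxV. Qed.
Let Hs i j : invmx G i j = invmx G j i.
Proof. by rewrite -{1}(inverse_sym GH1 G_sym) mxE. Qed.

(** theta is the projection orthogonal to u: the normalization gives u_j + u_j u^2 = 0. *)
Lemma theta_u j : \sum_r theta G u j r * raise G u r = 0.
Proof.
under eq_bigr do rewrite mulrDl.
rewrite big_split /=.
have -> : \sum_i G j i * raise G u i = u 0 j.
  rewrite -(contract_sharp_metric GH1 G_sym (fun k => u 0 k) j).
  by apply: eq_bigr => i _; rewrite mulrC.
under eq_bigr do rewrite -mulrA [u 0 _ * raise _ _ _]mulrC.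
by rewrite -mulr_sumr -/(norm2 G u) u_unit mulrN1 subrr.
Qed.

Lemma theta_up_u j : \sum_r theta_up G u j r * u 0 r = 0.
Proof.
transitivity (\sum_a invmx G j a * \sum_b theta G u a b * raise G u b).
  rewrite /theta_up; under eq_bigr do rewrite mulr_suml.
  rewrite exchange_big; apply: eq_bigr => a _ /=.
  under eq_bigr do rewrite mulr_suml.
  rewrite exchange_big mulr_sumr; apply: eq_bigr => b _ /=.
  rewrite /raise !mulr_sumr; apply: eq_bigr => r _.
  by rewrite (Hs r b); ring.
by rewrite big1// => a _; rewrite theta_u mulr0.
Qed.

(** Each summand of the tensor has a factor [v] in one of its two indices, so projecting both
    indices off [v] kills it. It serves for theta with lower indices and for theta with upper
    indices. *)
Lemma sum_transverse (P Q v y z : 'I_n -> R) :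
  \sum_r P r * v r = 0 -> \sum_s Q s * v s = 0 ->
  \sum_r \sum_s P r * Q s * (v r * y s + v s * z r) = 0.
Proof.
move=> Pv Qv.
transitivity ((\sum_r P r * v r) * (\sum_s Q s * y s)
              + (\sum_r P r * z r) * (\sum_s Q s * v s)).
  rewrite !big_distrlr -big_split; apply: eq_bigr => r _.
  by rewrite -big_split; apply: eq_bigr => s _ /=; ring.
by rewrite Pv Qv mul0r mulr0 addr0.
Qed.

(** Pair symmetry turns u_p C^bprs into u_p C^rsbp, where u meets the last index and [C_u] applies;
    [y] and [z] are the raised [Y] and [Z] for fixed b. *)
Lemma raise4_u b : exists y z : 'I_n -> R, forall r s,
  \sum_p u 0 p * raise4 G C b p r s = raise G u r * y s + raise G u s * z r.
Proof.
pose H := invmx G.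
exists (fun s => \sum_a H b a * \sum_d H s d * Y d a).
exists (fun r => \sum_a H b a * \sum_c H r c * Z c a).
move=> r s.
transitivity (\sum_a H b a * \sum_c \sum_d H r c * H s d *
    contract (raise G u) (C c d a)).
  rewrite /raise4; under eq_bigr do rewrite mulr_sumr.
  rewrite exchange_big; apply: eq_bigr => a _ /=.
  rewrite mulr_sumr; under [RHS]eq_bigr do rewrite mulr_sumr.
  under eq_bigr do rewrite mulr_sumr.
  under eq_bigr do under eq_bigr do rewrite mulr_sumr.
  under eq_bigr do rewrite exchange_big.
  rewrite exchange_big; apply: eq_bigr => c _ /=.
  under eq_bigr do under eq_bigr do rewrite mulr_sumr.
  under eq_bigr do rewrite exchange_big.
  rewrite exchange_big; apply: eq_bigr => d _ /=.
  rewrite exchange_big /contract !mulr_sumr; apply: eq_bigr => e _ /=.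
  rewrite /raise mulr_suml !mulr_sumr; apply: eq_bigr => p _.
  by rewrite (C_pair c) (Hs e) /H; ring.
rewrite !mulr_sumr -big_split; apply: eq_bigr => a _ /=.
rewrite !(mulrCA _ (H b a)) -mulrDr; congr (_ * _).
rewrite /raise -/H !big_distrlr -[X in _ = _ + X]exchange_big /= -big_split.
apply: eq_bigr => c _ /=; rewrite -big_split; apply: eq_bigr => d _ /=.
by rewrite C_u; ring.
Qed.

Lemma magnetic_eq0 j k m l : magnetic G C u j k m l = 0.
Proof.
rewrite /magnetic.
rewrite [X in 2 * X + _](_ : _ = 0) ?[X in _ + 2 * X](_ : _ = 0); last 2 first.
(* The second half of the magnetic part is a combination of u^j [w k] and u^k [w j], so it suffices
   that [w] vanishes. *)
- pose w b := \sum_p \sum_r \sum_s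
    u 0 p * raise4 G C b p r s * theta G u r l * theta G u s m.
  have w0 b : w b = 0.
    have [y [z E]] := raise4_u b.
    rewrite /w exchange_big /=; under eq_bigr do rewrite exchange_big /=.
    transitivity (\sum_r \sum_s theta G u r l * theta G u s m *
        (raise G u r * y s + raise G u s * z r)).
      apply: eq_bigr => r _; apply: eq_bigr => s _.
      rewrite -E mulr_sumr; apply: eq_bigr => p _; ring.
    by apply: sum_transverse; under eq_bigr => ? _ do
      rewrite /theta Gs [u 0 _ * u 0 _]mulrC; exact: theta_u.
  transitivity (2^-1 * (raise G u j * w k - raise G u k * w j)).
    rewrite /w !mulr_sumr -sumrB mulr_sumr; apply: eq_bigr => p _.
    rewrite !mulr_sumr -sumrB mulr_sumr; apply: eq_bigr => r _.
    rewrite !mulr_sumr -sumrB mulr_sumr; apply: eq_bigr => s _.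
    by rewrite /antisym; ring.
  by rewrite !w0 !mulr0 subrr mulr0.
(* In the first half u^p meets the third index of C; [C34] moves it to the last one, which exchanges
   l and m up to sign. *)
- transitivity (\sum_r \sum_s theta_up G u j r * theta_up G u k s *
    (u 0 r * (2^-1 * (Y s m * u 0 l - Y s l * u 0 m))
    + u 0 s * (2^-1 * (Z r m * u 0 l - Z r l * u 0 m)))); last first.
    by apply: sum_transverse; exact: theta_up_u.
  apply: eq_bigr => r _; apply: eq_bigr => s _.
  transitivity (theta_up G u j r * theta_up G u k s * (2^-1 *
    (contract (raise G u) (C r s m) * u 0 l
     - contract (raise G u) (C r s l) * u 0 m))); last by rewrite !C_u; ring.
  move: (_ * _) => q.
  rewrite /contract !mulr_suml -sumrB !mulr_sumr; apply: eq_bigr => p _.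
  by rewrite /antisym (C34 r s p l) (C34 r s p m); ring.
by rewrite !mulr0 addr0.
Qed.

End MagneticPart.

(** * Curvature and the Bianchi identities *)

Section MatrixFields.
Variables (R : realType) (n m : nat) (U : set 'rV[R]_n).
Hypothesis U_open : open U.
Implicit Types (M N : 'rV[R]_n -> 'M[R]_m).

Definition smooth_mx M := forall a b, smooth_on U (fun x => M x a b).

Definition partial_mx (i : 'I_n) M (x : 'rV[R]_n) : 'M[R]_m :=
  \matrix_(a, b) partial i (fun y => M y a b) x.

Lemma smooth_partial_mx i M : smooth_mx M -> smooth_mx (partial_mx i M).
Proof.
move=> sM a b; apply: smooth_ext (smooth_partial i (sM a b)) => // x _.
by rewrite mxE.
Qed.

Lemma smooth_mxD M N :
  smooth_mx M -> smooth_mx N -> smooth_mx (fun x => M x + N x).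
Proof.
move=> sM sN a b; apply: smooth_ext (smoothD U_open (sM a b) (sN a b)) => // x _.
by rewrite mxE.
Qed.

Lemma smooth_mxN M : smooth_mx M -> smooth_mx (fun x => - M x).
Proof.
move=> sM a b; apply: smooth_ext (smoothN U_open (sM a b)) => // x _.
by rewrite mxE.
Qed.

Lemma smooth_mxM M N :
  smooth_mx M -> smooth_mx N -> smooth_mx (fun x => M x *m N x).
Proof.
move=> sM sN a b.
apply: (@smooth_ext _ _ _ U_open (fun x => \sum_k M x a k * N x k b)).
  by move=> x _; rewrite mxE.
by apply: smooth_sum => // k; apply: smoothM.
Qed.

Section Rules.
Variables (i : 'I_n) (x : 'rV[R]_n).
Hypothesis Ux : U x.

Lemma partial_mx_ext M N : (forall y, U y -> M y = N y) ->
  partial_mx i M x = partial_mx i N x.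
Proof.
move=> MN; apply/matrixP => a b; rewrite !mxE.
by apply: partial_ext Ux => // y /MN->.
Qed.

Lemma partial_mxD M N : smooth_mx M -> smooth_mx N ->
  partial_mx i (fun y => M y + N y) x = partial_mx i M x + partial_mx i N x.
Proof.
move=> sM sN; apply/matrixP => a b; rewrite !mxE -(partialD _ Ux)//.
by apply: partial_ext Ux => // y _; rewrite mxE.
Qed.

Lemma partial_mxN M : smooth_mx M ->
  partial_mx i (fun y => - M y) x = - partial_mx i M x.
Proof.
move=> sM; apply/matrixP => a b; rewrite !mxE -(partialN _ Ux)//.
by apply: partial_ext Ux => // y _; rewrite mxE.
Qed.

Lemma partial_mxM M N : smooth_mx M -> smooth_mx N ->
  partial_mx i (fun y => M y *m N y) x =
  partial_mx i M x *m N x + M x *m partial_mx i N x.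
Proof.
move=> sM sN; apply/matrixP => a b; rewrite !mxE.
transitivity (partial i (fun y => \sum_k M y a k * N y k b) x).
  by apply: partial_ext Ux => // y _; rewrite mxE.
rewrite (partial_sum U_open)//; last by move=> k; apply: smoothM.
rewrite -big_split; apply: eq_bigr => k _ /=.
by rewrite (partialM _ Ux)// !mxE.
Qed.

Lemma partial_mxT M : partial_mx i (fun y => (M y)^T) x = (partial_mx i M x)^T.
Proof.
apply/matrixP => a b; rewrite !mxE.
by apply: partial_ext Ux => // y _; rewrite mxE.
Qed.

Lemma partial_mxC j M : smooth_mx M ->
  partial_mx i (partial_mx j M) x = partial_mx j (partial_mx i M) x.
Proof.
move=> sM; apply/matrixP => a b; rewrite [LHS]mxE [RHS]mxE.
transitivity (partial i (partial j (fun y => M y a b)) x).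
  by apply: partial_ext Ux => // y _; rewrite mxE.
rewrite (partialC _ _ U_open (sM a b) Ux).
by apply: partial_ext Ux => // y _; rewrite mxE.
Qed.

End Rules.
End MatrixFields.

(** * Curvature identities as pure matrix and index algebra *)

Section MatrixIdentities.
Variables (R : realType) (n : nat).
Implicit Types (a b c p q g : 'M[R]_n).

(* [a], [b] are connection matrices, [p], [q] their derivatives, and the
   hypothesis is the symmetry of second derivatives of the metric [g]. *)
Lemma metric_curvature_antisym a b p q g : g^T = g ->
  (p *m g + a *m (b *m g + (b *m g)^T))
    + (p *m g + a *m (b *m g + (b *m g)^T))^T =
  (q *m g + b *m (a *m g + (a *m g)^T))
    + (q *m g + b *m (a *m g + (a *m g)^T))^T ->
  ((p - q + a *m b - b *m a) *m g)^T = - ((p - q + a *m b - b *m a) *m g).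
Proof.
move=> gs.
have tD (c d : 'M[R]_n) : (c + d)^T = c^T + d^T by exact: raddfD.
have tN (c : 'M[R]_n) : (- c)^T = - c^T by exact: raddfN.
rewrite !(mulmxDl, mulmxDr, mulNmx, tD, tN) !trmx_mul !mulmxA !trmxK !gs.
move: (p *m g) (g *m p^T) (q *m g) (g *m q^T) => p1 p2 q1 q2.
move: (a *m b *m g) (b *m a *m g) (a *m g *m b^T) (b *m g *m a^T)
  (g *m a^T *m b^T) (g *m b^T *m a^T) => m1 m2 m3 m4 m5 m6.
move=> /matrixP E; apply/matrixP => i j; move: (E i j).
by rewrite !mxE => {}E; lra.
Qed.

(** The classical octahedron argument: a signed sum of four cyclic identities, one for each choice
    of the index kept last, leaves twice the claim. *)
Lemma pair_symmetry (r : 'I_n -> 'I_n -> 'I_n -> 'I_n -> R) :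
  (forall j k l m, r j k l m = - r k j l m) ->
  (forall j k l m, r j k l m = - r j k m l) ->
  (forall j k l m, r j k l m + r k l j m + r l j k m = 0) ->
  forall j k l m, r j k l m = r l m j k.
Proof.
move=> r12 r34 cyc j k l m.
have := cyc j k l m; have := cyc k l m j; have := cyc l m j k; have := cyc m j k l.
rewrite (r34 k l m j) (r34 l m k j) (r12 m k l j) (r12 m j l k) (r34 j m l k).
rewrite (r12 j l m k) (r34 l j m k) (r12 m j k l) (r34 j k m l) (r34 k m j l).
lra.
Qed.

(** Here [dab] is the derivative in direction a of the connection matrix b, and [habc] the second
    derivative of c in directions a and b. That each [h] occurs in two rows encodes the symmetry of
    second derivatives. *)
Lemma second_bianchi_mx (a b c dab dba dac dca dbc dcb : 'M[R]_n) :
  let Fab := dba - dab + a *m b - b *m a in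
  let Fbc := dcb - dbc + b *m c - c *m b in
  let Fca := dac - dca + c *m a - a *m c in
  forall hacb habc hbca: 'M[R]_n,
  (hacb - habc + (dab *m c + b *m dac) - (dac *m b + c *m dab) - a *m Fbc + Fbc *m a)
  + (habc - hbca + (dbc *m a + c *m dba) - (dba *m c + a *m dbc) - b *m Fca + Fca *m b)
  + (hbca - hacb + (dca *m b + a *m dcb) - (dcb *m a + b *m dca) - c *m Fab + Fab *m c)
  = 0.
Proof.
move=> Fab Fbc Fca h1 h2 h3; rewrite /Fab /Fbc /Fca.
rewrite !(mulmxDl, mulmxDr, mulNmx, mulmxN, mulmxA).
have eD (p q : 'M[R]_n) i j : (p + q) i j = p i j + q i j by rewrite mxE.
have eN (p : 'M[R]_n) i j : (- p) i j = - p i j by rewrite mxE.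
by apply/matrixP => i j; rewrite !(eD, eN) [RHS]mxE; ring.
Qed.

End MatrixIdentities.

(** * Christoffel symbols on a chart *)

Section Christoffel.
Variables (R : realType) (n : nat) (U : set 'rV[R]_n).
Variable G : 'rV[R]_n -> 'M[R]_n.
Hypotheses (U_open : open U) (G_smooth : smooth_mx U G).
Hypothesis G_sym : forall x, U x -> (G x)^T = G x.
Hypothesis G_unit : forall x, U x -> G x \in unitmx.

Let Gs x i j : U x -> G x i j = G x j i.
Proof. by move=> Ux; rewrite -{1}(G_sym Ux) mxE. Qed.
Let GH1 x : U x -> G x *m ginv G x = 1%:M.
Proof. by move=> /G_unit; exact: mulmxV. Qed.

Let ginv_smooth : smooth_mx U (ginv G).
Proof. exact: smooth_invmx. Qed.

Lemma christoffel_smooth p i j : smooth_on U (christoffel G p i j).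
Proof.
apply: smoothM => //; first exact: smooth_cst.
apply: smooth_sum => // q; apply: smoothM => //.
by apply: smoothB => //; [apply: smoothD => //|]; apply: smooth_partial.
Qed.

Lemma christoffelC p i j x : U x -> christoffel G p i j x = christoffel G p j i x.
Proof.
move=> Ux; rewrite /christoffel; congr (_ * _); apply: eq_bigr => q _.
rewrite [partial i _ x + _]addrC; congr (_ * (_ - _)).
by apply: partial_ext Ux => // y Uy; exact: Gs.
Qed.

Lemma christoffel_low i j k x : U x ->
  \sum_p christoffel G p i j x * G x p k =
  2^-1 * (partial i (fun y => G y k j) x + partial j (fun y => G y k i) x
          - partial k (fun y => G y i j) x).
Proof.
move=> Ux; rewrite /christoffel.
under eq_bigr do rewrite -mulrA mulr_suml.
rewrite -mulr_sumr exchange_big /=; congr (_ * _).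
rewrite -[RHS](sum_delta k (fun q => partial i (fun y => G y q j) x
  + partial j (fun y => G y q i) x - partial q (fun y => G y i j) x)).
apply: eq_bigr => q _; rewrite -(GH1 Ux) mxE mulr_suml; apply: eq_bigr => p _.
by rewrite (Gs k p Ux); ring.
Qed.

End Christoffel.

(** * Symmetries and Bianchi identities of the Riemann tensor *)

Section Curvature.
Variables (R : realType) (n : nat) (U : set 'rV[R]_n).
Variable G : 'rV[R]_n -> 'M[R]_n.
Hypotheses (U_open : open U) (G_smooth : smooth_mx U G).
Hypothesis G_sym : forall x, U x -> (G x)^T = G x.
Hypothesis G_unit : forall x, U x -> G x \in unitmx.
(* Keeping the Christoffel symbols abstract prevents conversion from unfolding
   them. *)
Variable Gam : 'I_n -> 'I_n -> 'I_n -> 'rV[R]_n -> R.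
Hypothesis GamE : christoffel G = Gam.

Let Gs x i j : U x -> G x i j = G x j i.
Proof. by move=> Ux; rewrite -{1}(G_sym Ux) mxE. Qed.

Let Gam_smooth p i j : smooth_on U (Gam p i j).
Proof. by rewrite -GamE; exact: christoffel_smooth. Qed.

Let GamC p i j x : U x -> Gam p i j x = Gam p j i x.
Proof. by rewrite -GamE; exact: christoffelC. Qed.

(** The lower index is the row, so that a column of covector components v has covariant derivative
    d_i v - Gamma_i v, and right multiplication by [G] lowers the upper index. *)
Definition connection (i : 'I_n) (x : 'rV[R]_n) : 'M[R]_n :=
  \matrix_(l, m) Gam m i l x.

Let connection_smooth i : smooth_mx U (connection i).
Proof.
move=> l m; apply: smooth_ext (Gam_smooth m i l) => // x _.
by rewrite mxE.
Qed.

Lemma metric_compatible i x : U x ->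
  partial_mx i G x = connection i x *m G x + (connection i x *m G x)^T.
Proof.
move=> Ux; apply/matrixP => j k; rewrite [LHS]mxE 3!mxE.
have E a b : \sum_p connection i x a p * G x p b =
    \sum_p Gam p i a x * G x p b.
  by apply: eq_bigr => p _; rewrite mxE.
rewrite [X in _ = _ + X]mxE !E -GamE !(christoffel_low G_sym G_unit _ _ _ Ux).
have Pc a b c : partial a (fun y => G y b c) x = partial a (fun y => G y c b) x.
  by apply: partial_ext Ux => // y Uy; exact: Gs.
by rewrite (Pc i k j) (Pc j k i) (Pc k j i); field.
Qed.

(** This is the commutator of d_j - Gamma_j and d_k - Gamma_k, in the sign convention of
    [riemann]. *)
Definition curvature : 'I_n -> 'I_n -> 'rV[R]_n -> 'M[R]_n :=
  locked (fun j k x =>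
    partial_mx k (connection j) x - partial_mx j (connection k) x
    + connection j x *m connection k x - connection k x *m connection j x).

Let dconnection_smooth i j : smooth_mx U (partial_mx i (connection j)).
Proof. exact: smooth_partial_mx. Qed.

Let dd_smooth j k :
  smooth_mx U (fun x => partial_mx k (connection j) x - partial_mx j (connection k) x).
Proof. by apply: smooth_mxD => //; apply: smooth_mxN. Qed.

Let AA_smooth j k : smooth_mx U (fun x => connection j x *m connection k x).
Proof. exact: smooth_mxM. Qed.

Lemma curvature_smooth j k : smooth_mx U (curvature j k).
Proof.
rewrite /curvature -lock; apply: smooth_mxD => //; last exact: smooth_mxN (AA_smooth k j).
exact: smooth_mxD (dd_smooth j k) (AA_smooth j k).
Qed.

Let mxD (p q : 'M[R]_n) i j : (p + q) i j = p i j + q i j.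
Proof. by rewrite mxE. Qed.
Let mxN (p : 'M[R]_n) i j : (- p) i j = - p i j.
Proof. by rewrite mxE. Qed.

Lemma curvatureE j k x l m : curvature j k x l m =
  partial k (Gam m j l) x - partial j (Gam m k l) x
  + \sum_p Gam p j l x * Gam m k p x
  - \sum_p Gam p k l x * Gam m j p x.
Proof.
have E a b c : (fun y => connection a y b c) = Gam c a b.
  by apply/funext => y; rewrite mxE.
have M a b : (connection a x *m connection b x) l m =
    \sum_p Gam p a l x * Gam m b p x.
  by rewrite mxE; apply: eq_bigr => p _; rewrite !mxE.
rewrite /curvature -lock !(mxD, mxN) !M.
by rewrite [X in X - _ + _ - _]mxE [X in _ - X + _ - _]mxE !E.
Qed.

Lemma riemannE j k l m x : U x -> riemann G j k l m x = curvature j k x l m.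
Proof.
move=> Ux.
(* The components of dx^m are constant, so only the connection term of its covariant derivative
   remains. *)
have E a b : nabla1 G (@dx R n m) a b = fun y => - Gam m a b y.
  apply/funext => y; rewrite /nabla1 /dx GamE (partial_cst y a) sub0r; congr (- _).
  rewrite -[RHS](sum_delta m (fun p => Gam p a b y)).
  by apply: eq_bigr => p _; rewrite mxE mulrC eq_sym.
rewrite /riemann /nabla2 GamE; move: (nabla1 G _) E => T E.
have S1 a b c : \sum_p Gam p a b x * T p c x =
    - \sum_p Gam p a b x * Gam m p c x.
  by rewrite -sumrN; apply: eq_bigr => p _; rewrite E mulrN.
have S2 a b c : \sum_p Gam p a b x * T c p x =
    - \sum_p Gam p a b x * Gam m c p x.
  by rewrite -sumrN; apply: eq_bigr => p _; rewrite E mulrN.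
rewrite !S1 !S2 !E !(partialN _ Ux); try exact: Gam_smooth.
rewrite curvatureE.
have -> : \sum_p Gam p k j x * Gam m p l x =
    \sum_p Gam p j k x * Gam m p l x.
  by apply: eq_bigr => p _; rewrite GamC.
by move: (@partial R n) => d; ring.
Qed.

Lemma curvature12 j k x : curvature j k x = - curvature k j x.
Proof.
apply/matrixP => l m; rewrite mxN !curvatureE.
by move: (@partial R n) => d; ring. Qed.

Lemma first_bianchi j k l m x : U x ->
  curvature j k x l m + curvature k l x j m + curvature l j x k m = 0.
Proof.
move=> Ux; rewrite !curvatureE.
have P a b c : partial a (Gam m b c) x = partial a (Gam m c b) x.
  by apply: partial_ext Ux => // y Uy; exact: GamC.
have S a b c : \sum_p Gam p a b x * Gam m c p x =
    \sum_p Gam p b a x * Gam m c p x.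
  by apply: eq_bigr => p _; rewrite GamC.
rewrite (P k j l) (P j k l) (P l k j) (S j l k) (S k l j) (S j k l).
by move: (@partial R n) => d; ring.
Qed.

Definition riem_low (j k l m : 'I_n) (x : 'rV[R]_n) : R :=
  (curvature j k x *m G x) l m.

Lemma riem_low12 j k l m x : riem_low j k l m x = - riem_low k j l m x.
Proof. by rewrite /riem_low curvature12 mulNmx mxN. Qed.

(** Differentiating [metric_compatible] once more expresses second derivatives of the metric through
    the connection; that they commute is the antisymmetry. *)
Lemma riem_low34 j k l m x : U x -> riem_low j k l m x = - riem_low j k m l x.
Proof.
move=> Ux.
have AG_smooth a : smooth_mx U (fun y => connection a y *m G y) by exact: smooth_mxM.
have D a b : partial_mx a (partial_mx b G) x =
    (partial_mx a (connection b) x *m G x + connection b x *m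
       (connection a x *m G x + (connection a x *m G x)^T))
    + (partial_mx a (connection b) x *m G x + connection b x *m
       (connection a x *m G x + (connection a x *m G x)^T))^T.
  rewrite (partial_mx_ext U_open _ Ux (@metric_compatible b)).
  have ST : smooth_mx U (fun y => (connection b y *m G y)^T).
    by move=> c d; apply: smooth_ext (AG_smooth b d c) => // y _; rewrite [RHS]mxE.
  rewrite (partial_mxD U_open _ Ux)// (partial_mxT U_open _ Ux).
  by rewrite (partial_mxM U_open _ Ux)// (metric_compatible a Ux).
have := partial_mxC U_open k Ux j G_smooth; rewrite !D.
move=> /(metric_curvature_antisym (G_sym Ux)) /matrixP/(_ m l).
by rewrite /riem_low /curvature -lock mxE mxN.
Qed.

Lemma riem_low_cyclic j k l m x : U x ->
  riem_low j k l m x + riem_low k l j m x + riem_low l j k m x = 0.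
Proof.
move=> Ux; rewrite /riem_low !mxE -!big_split big1// => p _ /=.
by rewrite -!mulrDl first_bianchi// mul0r.
Qed.

Lemma riem_low_pair j k l m x : U x -> riem_low j k l m x = riem_low l m j k x.
Proof.
move=> Ux; apply: (@pair_symmetry _ _ (fun a b c d => riem_low a b c d x)).
- by move=> *; exact: riem_low12.
- by move=> *; exact: riem_low34.
- by move=> *; exact: riem_low_cyclic.
Qed.

Lemma riem_low_smooth j k l m : smooth_on U (riem_low j k l m).
Proof. by apply: smooth_mxM => //; exact: curvature_smooth. Qed.

Lemma partial_curvature i j k x : U x ->
  partial_mx i (curvature j k) x =
  partial_mx i (partial_mx k (connection j)) x
  - partial_mx i (partial_mx j (connection k)) x
  + (partial_mx i (connection j) x *m connection k x
     + connection j x *m partial_mx i (connection k) x)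
  - (partial_mx i (connection k) x *m connection j x
     + connection k x *m partial_mx i (connection j) x).
Proof.
move=> Ux; rewrite /curvature -lock.
have dN a b : smooth_mx U (fun y => - partial_mx a (connection b) y).
  by apply: smooth_mxN.
rewrite (partial_mxD U_open _ Ux (smooth_mxD U_open (dd_smooth j k) (AA_smooth j k))
  (smooth_mxN U_open (AA_smooth k j))).
rewrite (partial_mxD U_open _ Ux (dd_smooth j k) (AA_smooth j k)).
rewrite (partial_mxD U_open _ Ux (dconnection_smooth k j) (dN j k)).
rewrite (partial_mxN U_open _ Ux (dconnection_smooth j k)).
rewrite (partial_mxN U_open _ Ux (AA_smooth k j)).
by rewrite !(partial_mxM U_open _ Ux).
Qed.

(** The covariant derivative d_i F - [Gamma_i, F] of the curvature as a matrix: it corrects for the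
    matrix indices l, m but not for j, k. *)
Definition nabla_curvature i j k x : 'M[R]_n :=
  partial_mx i (curvature j k) x - connection i x *m curvature j k x
  + curvature j k x *m connection i x.

Lemma nabla_curvature_cyclic i j k x : U x ->
  nabla_curvature i j k x + nabla_curvature j k i x + nabla_curvature k i j x = 0.
Proof.
move=> Ux; rewrite /nabla_curvature !(partial_curvature _ _ _ Ux).
rewrite (partial_mxC U_open j Ux i)// (partial_mxC U_open k Ux i)//.
rewrite (partial_mxC U_open k Ux j)//.
rewrite /curvature -lock; exact: second_bianchi_mx.
Qed.

Lemma nabla4_riem_low i j k l m x : U x ->
  nabla4 G riem_low i j k l m x =
  (nabla_curvature i j k x *m G x) l m
  - \sum_p Gam p i j x * riem_low p k l m x
  - \sum_p Gam p i k x * riem_low j p l m x.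
Proof.
move=> Ux; rewrite /nabla4 GamE.
have cs := @curvature_smooth j k.
have -> : partial i (riem_low j k l m) x =
    (partial_mx i (fun y => curvature j k y *m G y) x) l m by rewrite mxE.
rewrite (partial_mxM U_open _ Ux)// (metric_compatible _ Ux).
have -> : \sum_p Gam p i l x * riem_low j k p m x =
    (connection i x *m curvature j k x *m G x) l m.
  by rewrite -mulmxA mxE; apply: eq_bigr => p _; rewrite [connection _ _ _ _]mxE.
have -> : \sum_p Gam p i m x * riem_low j k l p x =
    (curvature j k x *m (connection i x *m G x)^T) l m.
  rewrite trmx_mul (G_sym Ux) mulmxA mxE; apply: eq_bigr => p _.
  by rewrite [(connection _ _)^T _ _]mxE [connection _ _ _ _]mxE mulrC.
rewrite /nabla_curvature mulmxDr !mulmxDl mulNmx !(mxD, mxN) mulmxA; ring.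
Qed.

(** The corrections for j and k left out of [nabla_curvature] cancel in the cyclic sum, since the
    Christoffel symbols are symmetric and the curvature is antisymmetric in its first pair. *)
Lemma second_bianchi i j k l m x : U x ->
  nabla4 G riem_low i j k l m x + nabla4 G riem_low j k i l m x
  + nabla4 G riem_low k i j l m x = 0.
Proof.
move=> Ux; rewrite !(nabla4_riem_low _ _ _ _ _ Ux).
have := congr1 (fun A : 'M[R]_n => (A *m G x) l m) (nabla_curvature_cyclic i j k Ux).
rewrite /= !mulmxDl !mxD mul0mx [X in _ = X]mxE.
have S a b c : \sum_p Gam p a b x * riem_low p c l m x =
    - \sum_p Gam p b a x * riem_low c p l m x.
  by rewrite -sumrN; apply: eq_bigr => p _; rewrite GamC// riem_low12 mulrN.
rewrite (S i j k) (S j k i) (S k i j) => E.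
by apply: etrans E; ring.
Qed.

End Curvature.

(** * The Weyl tensor *)

Section CovariantDerivative.
Variables (R : realType) (n : nat) (U : set 'rV[R]_n).
Variables (G : 'rV[R]_n -> 'M[R]_n) (x : 'rV[R]_n) (i : 'I_n).
Hypotheses (U_open : open U) (Ux : U x).
Implicit Types (S T : 'I_n -> 'I_n -> 'rV[R]_n -> R).
Implicit Types (V W : 'I_n -> 'I_n -> 'I_n -> 'I_n -> 'rV[R]_n -> R).

Lemma nabla4_ext V W j k l m :
  (forall y, U y -> forall j k l m, V j k l m y = W j k l m y) ->
  nabla4 G V i j k l m x = nabla4 G W i j k l m x.
Proof.
move=> VW; rewrite /nabla4.
rewrite (@partial_ext _ _ _ U_open _ (W j k l m))//; last by move=> y /VW.
by congr (_ - _ - _ - _ - _); apply: eq_bigr => p _; rewrite VW.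
Qed.

Lemma nabla4D V W j k l m :
  (forall j k l m, smooth_on U (V j k l m)) ->
  (forall j k l m, smooth_on U (W j k l m)) ->
  nabla4 G (fun j k l m y => V j k l m y + W j k l m y) i j k l m x =
  nabla4 G V i j k l m x + nabla4 G W i j k l m x.
Proof.
move=> sV sW; rewrite /nabla4 (partialD _ Ux)//.
move: (christoffel G) (partial i _ x) (partial i _ x) => Gam d1 d2.
have D f1 f2 a b : \sum_p Gam p a b x * (f1 p + f2 p) =
    \sum_p Gam p a b x * f1 p + \sum_p Gam p a b x * f2 p.
  by rewrite -big_split; apply: eq_bigr => p _ /=; rewrite mulrDr.
by rewrite !D; ring.
Qed.

Lemma nabla4B V W j k l m :
  (forall j k l m, smooth_on U (V j k l m)) ->
  (forall j k l m, smooth_on U (W j k l m)) ->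
  nabla4 G (fun j k l m y => V j k l m y - W j k l m y) i j k l m x =
  nabla4 G V i j k l m x - nabla4 G W i j k l m x.
Proof.
move=> sV sW; rewrite /nabla4 (partialB _ Ux)//.
move: (christoffel G) (partial i _ x) (partial i _ x) => Gam d1 d2.
have D f1 f2 a b : \sum_p Gam p a b x * (f1 p - f2 p) =
    \sum_p Gam p a b x * f1 p - \sum_p Gam p a b x * f2 p.
  by rewrite -sumrB; apply: eq_bigr => p _ /=; rewrite mulrBr.
by rewrite !D; ring.
Qed.

Lemma nabla4_swap V j k l m :
  nabla4 G (fun j k => V k j) i j k l m x = nabla4 G V i k j l m x.
Proof.
rewrite /nabla4; move: (christoffel G) (partial i _ x) => Gam d.
by congr (_ - _ - _); rewrite addrAC.
Qed.

(** The index pattern jm, kl, together with [nabla4_swap], covers all four terms of a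
    Kulkarni-Nomizu product. *)
Lemma nabla4_prod S T j k l m :
  (forall j k, smooth_on U (S j k)) -> (forall j k, smooth_on U (T j k)) ->
  nabla4 G (fun j k l m y => S j m y * T k l y) i j k l m x =
  nabla2 G S i j m x * T k l x + S j m x * nabla2 G T i k l x.
Proof.
move=> sS sT; rewrite /nabla4 /nabla2 (partialM _ Ux)//.
move: (christoffel G) (partial i _ x) (partial i _ x) => Gam d1 d2.
have Dl f c a b : \sum_p Gam p a b x * (f p * c) = (\sum_p Gam p a b x * f p) * c.
  by rewrite mulr_suml; apply: eq_bigr => p _; rewrite mulrA.
have Dr f c a b : \sum_p Gam p a b x * (c * f p) = c * (\sum_p Gam p a b x * f p).
  by rewrite mulr_sumr; apply: eq_bigr => p _; rewrite mulrCA.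
by rewrite !Dl !Dr; ring.
Qed.

End CovariantDerivative.

(** * The Weyl tensor: symmetries, trace and Bianchi identity *)

Section Weyl.
Variables (R : realType) (n : nat) (U : set 'rV[R]_n).
Variable G : 'rV[R]_n -> 'M[R]_n.
Hypotheses (U_open : open U) (G_smooth : smooth_mx U G).
Hypothesis G_sym : forall x, U x -> (G x)^T = G x.
Hypothesis G_unit : forall x, U x -> G x \in unitmx.
Hypothesis n_ge3 : (3 <= n)%N.
Variable Gam : 'I_n -> 'I_n -> 'I_n -> 'rV[R]_n -> R.
Hypothesis GamE : christoffel G = Gam.

Let Gs x i j : U x -> G x i j = G x j i.
Proof. by move=> Ux; rewrite -{1}(G_sym Ux) mxE. Qed.
Let GH1 x : U x -> G x *m ginv G x = 1%:M.
Proof. by move=> /G_unit; exact: mulmxV. Qed.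
Let HG1 x : U x -> ginv G x *m G x = 1%:M.
Proof. by move=> /G_unit; exact: mulVmx. Qed.
Local Notation Rm := (riem_low G Gam).

Lemma metric_parallel i j k x : U x ->
  nabla2 G (fun a b y => G y a b) i j k x = 0.
Proof.
move=> Ux; rewrite /nabla2 GamE.
have := congr1 (fun A : 'M[R]_n => A j k)
  (metric_compatible U_open G_sym G_unit GamE i Ux).
rewrite /= mxE => ->; rewrite 3!mxE.
have E a b : \sum_p connection Gam i x a p * G x p b =
    \sum_p Gam p i a x * G x p b.
  by apply: eq_bigr => p _; rewrite mxE.
rewrite E mxE E; have -> : \sum_p Gam p i k x * G x j p = \sum_p Gam p i k x * G x p j.
  by apply: eq_bigr => p _; rewrite (Gs j p Ux).
by ring.
Qed.

Lemma ricciE k l x : U x ->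
  ricci G k l x = - trace2 (ginv G x) (fun m p => Rm m k l p x).
Proof.
move=> Ux; rewrite /ricci; congr (- _); apply: eq_bigr => m _.
rewrite (riemannE U_open G_smooth G_sym G_unit GamE _ _ _ _ Ux).
rewrite -[curvature Gam m k x]mulmx1 -(GH1 Ux) mulmxA mxE.
apply: eq_bigr => p _; rewrite mulrC; congr (_ * _).
have := inverse_sym (GH1 Ux) (G_sym Ux) => /matrixP/(_ m p) <-.
by rewrite mxE.
Qed.

Lemma ricci_smooth k l : smooth_on U (ricci G k l).
Proof.
apply: (@smooth_ext _ _ _ U_open (fun x => - \sum_m curvature Gam m k x l m)).
  move=> x Ux; congr (- _); apply: eq_bigr => m _.
  by rewrite (riemannE U_open G_smooth G_sym G_unit GamE _ _ _ _ Ux).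
apply: smoothN => //; apply: smooth_sum => // m.
exact: (curvature_smooth U_open G_smooth G_unit GamE).
Qed.

Lemma ricci_sym k l x : U x -> ricci G k l x = ricci G l k x.
Proof.
move=> Ux; rewrite !ricciE//; congr (- _).
rewrite -[RHS](trace2T (GH1 Ux) (G_sym Ux)); apply: eq_trace2 => m p.
rewrite (riem_low_pair U_open G_smooth G_sym G_unit GamE _ _ _ _ Ux).
rewrite riem_low12 (riem_low34 U_open G_smooth G_sym G_unit GamE _ _ _ _ Ux).
by rewrite opprK.
Qed.

Lemma scalar_curv_smooth : smooth_on U (scalar_curv G).
Proof.
apply: smooth_sum => // a; apply: smooth_sum => // b; apply: smoothM => //.
  exact: smooth_invmx.
exact: ricci_smooth.
Qed.

(** The scalar term of the Weyl tensor is halved here because the Schouten tensor meets g twice in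
    [weylE], once on each side of the product. *)
Definition schouten (k l : 'I_n) (x : 'rV[R]_n) : R :=
  (n%:R - 2)^-1 * ricci G k l x
  - scalar_curv G x * (2 * (n%:R - 1) * (n%:R - 2))^-1 * G x k l.

Lemma schouten_smooth k l : smooth_on U (schouten k l).
Proof.
apply: smoothB => //; apply: smoothM => //.
- exact: smooth_cst.
- exact: ricci_smooth.
- by apply: smoothM => //; [exact: scalar_curv_smooth|exact: smooth_cst].
Qed.

Lemma schouten_sym k l x : U x -> schouten k l x = schouten l k x.
Proof. by move=> Ux; rewrite /schouten ricci_sym// (Gs k l Ux). Qed.

Let n2 : n%:R - 2 != 0 :> R.
Proof.
have : 3 <= n%:R :> R by rewrite (ler_nat _ 3).
by move=> ?; apply/eqP; lra.
Qed.
Let n1 : n%:R - 1 != 0 :> R.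
Proof.
have : 3 <= n%:R :> R by rewrite (ler_nat _ 3).
by move=> ?; apply/eqP; lra.
Qed.

Lemma weylE j k l m x : U x ->
  weyl G j k l m x = Rm j k l m x +
    (G x j m * schouten k l x - G x k m * schouten j l x
     + (schouten j m x * G x k l - schouten k m x * G x j l)).
Proof.
move=> Ux; pose w p := G x p m.
have Ed a : contract w (fun p => delta R a p) = G x a m.
  rewrite -[RHS](sum_delta a w).
  by apply: eq_bigr => p _; rewrite /delta mxE mulrC.
have Er a : contract w (fun p => ricci_mixed G a p x) = ricci G a m x.
  rewrite -[RHS](sum_delta m (fun p => ricci G a p x)).
  rewrite /contract /ricci_mixed; under eq_bigr do rewrite mulr_sumr.
  rewrite exchange_big; apply: eq_bigr => q _ /=.
  under eq_bigr do rewrite mulrCA.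
  rewrite -mulr_sumr mulrC; congr (_ * _).
  transitivity ((ginv G x *m G x) q m); last by rewrite HG1// !mxE eq_sym.
  by rewrite mxE; apply: eq_bigr => p _; rewrite mulrC.
have Ec : contract w (fun p => riemann G j k l p x) = Rm j k l m x.
  rewrite /riem_low mxE; apply: eq_bigr => p _.
  by rewrite (riemannE U_open G_smooth G_sym G_unit GamE _ _ _ _ Ux) mulrC.
transitivity (contract w (fun p => weyl_mixed G j k l p x)).
  by apply: eq_bigr => p _; rewrite mulrC.
rewrite /weyl_mixed; move: (riemann G) (ricci_mixed G) Er Ec => rm rx Er Ec.
rewrite !(contractD, contractN, contractZ, contractZr).
rewrite Ec !Ed !Er /schouten.
move: (Rm j k l m x) (scalar_curv G x) (ricci G) => r s ric.
by field; rewrite n1 n2.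
Qed.

Lemma weyl12 j k l m x : U x -> weyl G j k l m x = - weyl G k j l m x.
Proof. by move=> Ux; rewrite !weylE// (riem_low12 _ _ j k); ring. Qed.

Lemma weyl34 j k l m x : U x -> weyl G j k l m x = - weyl G j k m l x.
Proof.
move=> Ux; rewrite !weylE//.
rewrite (riem_low34 U_open G_smooth G_sym G_unit GamE _ _ _ _ Ux); ring.
Qed.

Lemma weyl_pair j k l m x : U x -> weyl G j k l m x = weyl G l m j k x.
Proof.
move=> Ux; rewrite !weylE//.
rewrite (riem_low_pair U_open G_smooth G_sym G_unit GamE _ _ _ _ Ux).
rewrite (Gs j m Ux) (Gs k m Ux) (Gs k l Ux) (Gs j l Ux).
rewrite (schouten_sym j m Ux) (schouten_sym k m Ux) (schouten_sym k l Ux).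
by rewrite (schouten_sym j l Ux); ring.
Qed.

(** It comes down to (n - 2) P_kl + g_kl tr P = R_kl for the Schouten tensor P, with tr P = R / (2
    (n - 1)). *)
Lemma weyl_trace k l x : U x ->
  trace2 (ginv G x) (fun j m => weyl G j k l m x) = 0.
Proof.
move=> Ux.
rewrite (eq_trace2 _ (fun j m => weylE j k l m Ux)).
rewrite !(trace2D, trace2N).
rewrite (trace2_metric (GH1 Ux) (G_sym Ux)).
rewrite (trace2_metricl (GH1 Ux) (G_sym Ux) k (fun j => schouten j l x)).
have -> : trace2 (ginv G x) (fun j m => schouten j m x * G x k l) =
    G x k l * trace2 (ginv G x) (fun j m => schouten j m x).
  by rewrite -trace2Z; apply: eq_trace2 => j m; rewrite mulrC.
have -> : trace2 (ginv G x) (fun j m => schouten k m x * G x j l) = schouten k l x.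
  rewrite -[RHS](trace2_metricr (GH1 Ux) (G_sym Ux) l (fun m => schouten k m x)).
  by apply: eq_trace2 => j m; rewrite mulrC.
have -> : trace2 (ginv G x) (fun j m => Rm j k l m x) = - ricci G k l x.
  by rewrite ricciE// opprK.
have -> : trace2 (ginv G x) (fun j m => schouten j m x) =
    (n%:R - 2)^-1 * scalar_curv G x
    - scalar_curv G x * (2 * (n%:R - 1) * (n%:R - 2))^-1 * n%:R.
  rewrite trace2D trace2N !trace2Z; congr (_ - _ * _).
  have := trace2_metric (GH1 Ux) (G_sym Ux) 1; rewrite mulr1 => <-.
  by apply: eq_trace2 => j m; rewrite mulr1.
rewrite /schouten.
move: (scalar_curv G x) (ricci G) => s ric.
by field; rewrite n1 n2.
Qed.

Definition cotton i k l x : R :=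
  nabla2 G schouten i k l x - nabla2 G schouten k i l x.

(** The metric is parallel, so derivatives of the product terms fall on the Schouten tensor and pair
    up into Cotton tensors, while the Riemann terms cancel by [second_bianchi]. *)
Lemma weyl_bianchi i j k l m x : U x ->
  nabla4 G (weyl G) i j k l m x + nabla4 G (weyl G) j k i l m x
  + nabla4 G (weyl G) k i j l m x =
  G x j m * cotton i k l x + G x k m * cotton j i l x + G x i m * cotton k j l x
  - (G x j l * cotton i k m x + G x k l * cotton j i m x
     + G x i l * cotton k j m x).
Proof.
move=> Ux.
pose g (a b : 'I_n) (y : 'rV[R]_n) := G y a b.
pose K (a b c d : 'I_n) y := g a d y * schouten b c y.
pose L (a b c d : 'I_n) y := schouten a d y * g b c y.
have sP := schouten_smooth.
have sK a b c d : smooth_on U (K a b c d).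
  by apply: smoothM => //; exact: G_smooth.
have sL a b c d : smooth_on U (L a b c d).
  by apply: smoothM => //; exact: G_smooth.
have sR := riem_low_smooth U_open G_smooth G_unit GamE.
have expand a b c : nabla4 G (weyl G) a b c l m x =
    nabla4 G Rm a b c l m x
    + (G x b m * nabla2 G schouten a c l x - G x c m * nabla2 G schouten a b l x
       + (nabla2 G schouten a b m x * G x c l
          - nabla2 G schouten a c m x * G x b l)).
  rewrite (nabla4_ext G a U_open Ux (W := fun b c d e y => Rm b c d e y +
      (K b c d e y - K c b d e y + (L b c d e y - L c b d e y))) b c l m
      (fun y Uy b c d e => @weylE b c d e y Uy)).
  rewrite (nabla4D (U := U))//; last first.
    by move=> *; apply: smoothD => //; apply: smoothB.
  pose KK (b c d e : 'I_n) y := K b c d e y - K c b d e y.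
  pose LL (b c d e : 'I_n) y := L b c d e y - L c b d e y.
  have sKK b' c' d e : smooth_on U (KK b' c' d e) by apply: smoothB.
  have sLL b' c' d e : smooth_on U (LL b' c' d e) by apply: smoothB.
  rewrite [X in _ + X](nabla4D G a Ux b c l m sKK sLL).
  rewrite !(nabla4B (U := U))//.
  rewrite (nabla4_swap _ _ _ K) (nabla4_swap _ _ _ L).
  rewrite !(nabla4_prod (U := U))// !metric_parallel//.
  by rewrite !mul0r !mulr0 !add0r !addr0.
rewrite !expand /cotton.
have := second_bianchi U_open G_smooth G_sym G_unit GamE i j k l m Ux.
move: (nabla2 G schouten) (nabla4 G Rm) => D r E.
rewrite -[RHS]add0r -E.
by rewrite (Gs k l Ux) (Gs j l Ux) (Gs i l Ux); ring.
Qed.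

End Weyl.

(** One negative and n - 1 positive roots exhaust the degree n of the characteristic polynomial, so
    0 is not an eigenvalue. *)
Lemma lorentz_unitmx (R : realType) (n : nat) (A : 'M[R]_n) :
  (0 < n)%N -> lorentz_signature A -> A \in unitmx.
Proof.
move=> n0 [s [sE neg pos]].
have size_s : size s = n.
  have := congr1 (fun p : {poly R} => size p) sE.
  by rewrite /= size_char_poly size_prod_XsubC => -[].
have s0 : 0 \notin s.
  rewrite -has_pred1 has_count -leqNgt leqn0.
  have E : (count (fun z : R => z < 0)%R s + count (fun z : R => 0 < z)%R s
      + count (pred1 (0%R : R)) s = size s)%N.
    rewrite -(count_predT s); elim: (s) => //= z s' <-.
    by case: (ltrgtP z 0) => _ /=; ring.
  by move: E; rewrite neg pos size_s add1n prednK// -{2}[n]addn0 => /addnI/eqP.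
rewrite unitmxE unitfE; apply: contraNneq s0 => d0.
have : root (char_poly A) 0.
  by rewrite /root horner_coef0 char_poly_det d0 mulr0.
by rewrite sE root_prod_XsubC.
Qed.

Theorem proposition5p1 (R : realType) (n : nat) (M : smooth_manifold R n)
    (g : sym_tensor_field M) (alpha : covector_field M)
    (n_ge5 : (5 <= n)%N)
    (g_lorentz : lorentzian g)
    (g_recurrent : conformally_recurrent g alpha)
    (alpha_timelike : timelike g alpha) :
  weyl_purely_electric g (unit_covector g alpha).
Proof.
move=> c x Ux j k m l.
have U_open : open (chart_cod (atlas c)) by exact: chart_cod_open.
have G_smooth : smooth_mx (chart_cod (atlas c)) (g c) by exact: met_smooth.
have G_sym y : chart_cod (atlas c) y -> (g c y)^T = g c y by exact: met_sym.
have G_unit y : chart_cod (atlas c) y -> g c y \in unitmx.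
  by move=> /g_lorentz; apply: lorentz_unitmx; exact: leq_trans n_ge5.
have n_ge3 : (3 <= n)%N by exact: leq_trans n_ge5.
pose al i := alpha c x 0 i.
(* [contract] and [sharp] unfold to the same sums as [norm2] and [raise]. *)
have N0 : contract (sharp (invmx (g c x)) al) al < 0 := alpha_timelike c x Ux.
(* With [erefl] the abstract [Gam] becomes the Christoffel symbols themselves. *)
have W12 a b d e := weyl12 U_open G_smooth G_sym G_unit n_ge3 erefl a b d e Ux.
have W34 a b d e := weyl34 U_open G_smooth G_sym G_unit n_ge3 erefl a b d e Ux.
have Wpair a b d e := weyl_pair U_open G_smooth G_sym G_unit n_ge3 erefl a b d e Ux.
have Wtr a b := weyl_trace U_open G_smooth G_sym G_unit n_ge3 erefl a b Ux.
have Wbianchi i a b d e :=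
  weyl_bianchi U_open G_smooth G_sym G_unit n_ge3 erefl i a b d e Ux.
have recurrence i a b d e : nabla4 (g c) (weyl (g c)) i a b d e x =
    al i * weyl (g c) a b d e x by have [_] := g_recurrent; apply.
have [||Y [Z X_YZ]] := @weyl_recurrence_contracted R n (g c x) (invmx (g c x))
  (mulmxV (G_unit x Ux)) (G_sym x Ux) n_ge5 (fun a b d e => weyl (g c) a b d e x)
  (fun i a b => cotton (g c) i a b x) al W12 W34 Wtr _ _ (ltr0_neq0 N0).
- by move=> i a b; rewrite /cotton [RHS]opprB.
- by move=> i a b d e; rewrite -!recurrence; exact: Wbianchi.
pose lam := (Num.sqrt (- norm2 (g c x) (alpha c x)))^-1.
have raise_u a : raise (g c x) (unit_covector g alpha c x) a =
    lam * sharp (invmx (g c x)) al a.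
  rewrite /raise /sharp mulr_sumr; apply: eq_bigr => b _.
  by rewrite /unit_covector mxE mulrCA.
(* The square root squares back to its argument because -alpha^2 is positive. *)
have lam2 : lam ^+ 2 * norm2 (g c x) (alpha c x) = -1.
  rewrite /lam exprVn sqr_sqrtr ?oppr_ge0 ?ltW// invrN mulNr mulVf//.
  exact: ltr0_neq0.
apply: (magnetic_eq0 (G_unit x Ux) (G_sym x Ux) W34 Wpair (Y := Y) (Z := Z)).
(* Passing from alpha to u multiplies both sides by [lam] once, so the same [Y] and [Z] serve. *)
- move=> a b d; rewrite /unit_covector !mxE -/lam -!mulrA -mulrDr -/(al a) -/(al b).
  rewrite -X_YZ /contract mulr_sumr; apply: eq_bigr => e _.
  by rewrite raise_u mulrA.
- rewrite -lam2 /norm2 mulr_sumr; apply: eq_bigr => a _.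
  by rewrite raise_u /unit_covector mxE -/lam /sharp /raise; ring.
Qed.
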